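(* Let $A$ and $B$ be unital $C^{*}$-algebras with identity elements $I_A$ and $I_B$, and let ${\mathcal A}$ and ${\mathcal B}$ be open subgroups of $A^{-1}$ and $B^{-1}$ respectively. Suppose that $T$ is a bijection from ${\mathcal A}$ onto ${\mathcal B}$. Then $T$ is an isometry if and only if $T(I_A)$ is unitary in $B$ and there are a central projection $P$ in $B$ and a surjective Jordan $*$-isomorphism $J$ from $A$ onto $B$ such that $$T(a)=T(I_A)PJ(a)+T(I_A)(I_B-P)J(a)^*\quad\text{for all } a\in {\mathcal A}.$$ Furthermore, in this case (for such $P$ and $J$) the operator $a\mapsto T(I_A)PJ(a)+T(I_A)(I_B-P)J(a)^*$, $a\in A$, defines a surjective real-linear isometry from $A$ onto $B$.
   Context: $C^*$-algebras are over the complex numbers. For a unital $C^*$-algebra $A$, $A^{-1}$ denotes the group of all invertible elements of $A$, which is an open subset of $A$ in the norm topology; an open subgroup of $A^{-1}$ is a subgroup of $A^{-1}$ that is open. An isometry from ${\mathcal A}$ to ${\mathcal B}$ is a map preserving distances as a map of metric spaces, i.e. $\|T(a)-T(b)\|=\|a-b\|$ for all $a,b\in{\mathcal A}$ (no linearity or multiplicativity is assumed). A central projection in $B$ is a projection ($P=P^*=P^2$) that lies in the center of $B$. A Jordan $*$-isomorphism from $A$ onto $B$ is a complex-linear bijection $J:A\to B$ with $J(a^2)=J(a)^2$ and $J(a^* )=J(a)^*$ for all $a\in A$. *)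

(* Defs.v *)
From HB Require Import structures.
From mathcomp Require Import all_boot all_order all_algebra.
From mathcomp Require Import complex.
From mathcomp Require Import all_classical all_reals all_analysis.

Set Implicit Arguments.
Unset Strict Implicit.
Unset Printing Implicit Defensive.

Import Order.TTheory GRing.Theory Num.Theory.
Import numFieldNormedType.Exports.

Local Open Scope classical_set_scope.
Local Open Scope ring_scope.

(* Unital C*-algebras over R[i].  The product, unit and involution are fields on
   top of a library Banach space: Hierarchy Builder cannot join a ring structure
   with a normed space structure, since numDomainType already inherits from
   both.  The library's ring structure is then installed on the carrier.  The
   norm takes its values in R[i], where x <= y means that y - x is a nonnegative
   real.  The zero algebra is allowed. *)
Record cstarAlg (R : realType) := CStarAlg {
  cstar_space : completeNormedModType R[i];
  cstar_one : cstar_space;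
  cstar_mul : cstar_space -> cstar_space -> cstar_space;
  cstar_star : cstar_space -> cstar_space;
  cstar_mulA : associative cstar_mul;
  cstar_mul1l : left_id cstar_one cstar_mul;
  cstar_mul1r : right_id cstar_one cstar_mul;
  cstar_mulDl : left_distributive cstar_mul +%R;
  cstar_mulDr : right_distributive cstar_mul +%R;
  cstar_scaleAl : forall (k : R[i]) (x y : cstar_space),
    k *: cstar_mul x y = cstar_mul (k *: x) y;
  cstar_scaleAr : forall (k : R[i]) (x y : cstar_space),
    k *: cstar_mul x y = cstar_mul x (k *: y);
  cstar_normM : forall x y : cstar_space, `|cstar_mul x y| <= `|x| * `|y|;
  cstar_starD : forall x y : cstar_space,
    cstar_star (x + y) = cstar_star x + cstar_star y;
  cstar_starZ : forall (k : R[i]) (x : cstar_space),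
    cstar_star (k *: x) = k^* *: cstar_star x;
  cstar_starM : forall x y : cstar_space,
    cstar_star (cstar_mul x y) = cstar_mul (cstar_star y) (cstar_star x);
  cstar_starK : forall x : cstar_space, cstar_star (cstar_star x) = x;
  cstar_identity : forall x : cstar_space,
    `|cstar_mul (cstar_star x) x| = `|x| ^+ 2
}.

Definition cstar_sort (R : realType) (A : cstarAlg R) : Type := cstar_space A.
Coercion cstar_sort : cstarAlg >-> Sortclass.

HB.instance Definition _ (R : realType) (A : cstarAlg R) :=
  CompleteNormedModule.copy (cstar_sort A) (cstar_space A).

HB.instance Definition _ (R : realType) (A : cstarAlg R) :=
  GRing.Zmodule_isPzRing.Build (cstar_sort A)
    (@cstar_mulA R A) (@cstar_mul1l R A) (@cstar_mul1r R A)
    (@cstar_mulDl R A) (@cstar_mulDr R A).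

Definition star (R : realType) (A : cstarAlg R) (x : A) : A := cstar_star x.

Section CStarDefs.
Variable R : realType.
Implicit Types A B : cstarAlg R.

Definition inverses A (a b : A) : Prop := a * b = 1 /\ b * a = 1.

Definition invertibles A : set A := [set a | exists b : A, inverses a b].
Arguments invertibles A : clear implicits.

(* As A^{-1} is open in A, being open in A^{-1} amounts to being open in A. *)
Definition open_subgroup A (G : set A) : Prop :=
  [/\ G `<=` invertibles A, G 1,
      forall a b, G a -> G b -> G (a * b),
      forall a b, G a -> inverses a b -> G b
    & open G].

Definition unitary A (u : A) : Prop := star u * u = 1 /\ u * star u = 1.

Definition central_projection A (p : A) : Prop :=
  [/\ star p = p, p * p = p & forall b : A, p * b = b * p].

Definition jordan_star_iso A B (J : A -> B) : Prop :=
  [/\ linear J, bijective J,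
      forall a : A, J (a * a) = J a * J a
    & forall a : A, J (star a) = star (J a)].

Definition isometry_on A B (G : set A) (T : A -> B) : Prop :=
  forall a b, G a -> G b -> `|T a - T b| = `|a - b|.

(* R[i] is not an R-module in the library, so real scalars are embedded
   in R[i]. *)
Definition real_linear A B (S : A -> B) : Prop :=
  (forall a b : A, S (a + b) = S a + S b) /\
  (forall (r : R) (a : A), S (r%:C%C *: a) = r%:C%C *: S a).

Definition jordan_form A B (u p : B) (J : A -> B) (a : A) : B :=
  u * p * J a + u * (1 - p) * star (J a).

End CStarDefs.

(* Main.v *)
(** A surjective isometry between open sets is locally affine (Mazur-Ulam), and its
    linear part is constant along segments.  As an open subgroup is stable under
    nonzero scalars, comparing T on rays with T near large scalars shows that T is
    the restriction of a surjective real-linear isometry L.  The unit is extreme in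
    the ball, and an invertible extreme point is unitary, so u = T(1) is unitary and
    F = u^* L is unital.  For a unitary v close to 1 the map F^-1 (v F(.)) is, up to
    a unitary factor, unital and close to the identity, hence complex-linear; so
    F i F^-1 commutes with all multiplications, s = F(i) is central with s^2 = -1,
    and P = (1 - i s) / 2 splits F into a complex-linear and a conjugate-linear part.
    Kadison's theorem for J = P F + (1 - P) F^* follows by expanding the images of
    unitaries to second order.  Conversely the maps involved preserve the triple
    product x x^* x, hence are contractive together with their inverses.

    The spectral input is elementary: if h is self-adjoint and nonzero, |h| - h and
    |h| + h, with |h| the norm, are not both invertible. *)

Require Import Defs.
From mathcomp Require Import all_boot all_order all_algebra.
From mathcomp Require Import complex.
From mathcomp Require Import all_classical all_reals all_analysis.
From mathcomp Require Import ring lra.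
From Stdlib Require Ncring_tac.

Set Implicit Arguments.
Unset Strict Implicit.
Unset Printing Implicit Defensive.

Import Order.TTheory GRing.Theory Num.Theory.
Import numFieldNormedType.Exports.

Local Open Scope classical_set_scope.
Local Open Scope ring_scope.

(** No functional calculus is used: Neumann series and square roots of [1 - x] do its work. The
    recurring device completes a self-adjoint contraction h to a unitary h + i c with c^2 = 1 - h^2,
    so that facts about unitaries reach self-adjoint elements. A real-linear isometry knows nothing
    of products, so algebra has to be recovered from norms: x is skew exactly when |1 + t x|^2 = 1 +
    O(t^2) for real t, which is a metric condition. On the group side the obstacle is that an open
    subgroup need be neither convex nor connected, so affine pieces of T in different components are
    tied together only by distances. The group does contain the positive scalars and i. For a in the
    group and k in {1, i, -1, -i}, the element s k + a = s (k + a / s) is, for large s, a multiple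
    of a point near k, where T is known; its distance to a then tests T a. *)

#[local] Instance pzRing_ncring_ops (T : pzRingType) :
  @Ncring.Ring_ops T 0 1 +%R *%R (fun x y => x - y) -%R eq := {}.
#[local] Instance pzRing_ncring (T : pzRingType) : Ncring.Ring (Ro := pzRing_ncring_ops T).
Proof.
split; try by (repeat (move=> ? ? ->)).
- exact: RelationClasses.eq_equivalence.
- exact: (@add0r T).
- exact: (@addrC T).
- exact: (@addrA T).
- exact: (@mul1r T).
- exact: (@mulr1 T).
- exact: (@mulrA T).
- exact: (@mulrDl T).
- by move=> x y z; exact: (@mulrDr T).
- exact: (@subrr T).
Qed.

Ltac ncring := Ncring_tac.non_commutative_ring.

Local Notation "r *r x" := (real_complex _ r *: x) (at level 40).

(** * Real-valued norm and completeness *)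

Section RealNorm.
Variables (R : realType) (A : cstarAlg R).
Implicit Types (x y z : A) (k : R[i]) (r : R).

Definition nrm x : R := complex.Re `|x|.

Lemma normE x : `|x| = (nrm x)%:C%C.
Proof. by rewrite /nrm RRe_real // ger0_real. Qed.

Lemma nrm_ge0 x : 0 <= nrm x.
Proof. by rewrite -ler0c -normE. Qed.

Lemma nrm0 : nrm (0 : A) = 0.
Proof. by rewrite /nrm normr0. Qed.

Lemma nrm_eq0 x : nrm x = 0 -> x = 0.
Proof. by move=> h; apply/normr0_eq0; rewrite normE h. Qed.

Lemma nrm_gt0 x : x <> 0 -> 0 < nrm x.
Proof.
move=> x0; rewrite lt_neqAle nrm_ge0 andbT eq_sym.
by apply/eqP => /nrm_eq0.
Qed.

Lemma nrmD x y : nrm (x + y) <= nrm x + nrm y.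
Proof. by rewrite -lecR rmorphD /= -!normE ler_normD. Qed.

Lemma nrmN x : nrm (- x) = nrm x.
Proof. by rewrite /nrm normrN. Qed.

Lemma nrmB x y : nrm (x - y) <= nrm x + nrm y.
Proof. by rewrite -(nrmN y); exact: nrmD. Qed.

Lemma nrm_distC x y : nrm (x - y) = nrm (y - x).
Proof. by rewrite /nrm distrC. Qed.

Lemma nrm_triangle y x z : nrm (x - z) <= nrm (x - y) + nrm (y - z).
Proof. by rewrite (_ : x - z = (x - y) + (y - z)) ?nrmD //; ncring. Qed.

Lemma nrmZ k x : nrm (k *: x) = complex.Re `|k| * nrm x.
Proof.
rewrite {1}/nrm normrZ normE -{1}(@RRe_real _ `|k|) ?ger0_real //.
by rewrite -rmorphM.
Qed.

Lemma nrmZr r x : nrm (r *r x) = `|r| * nrm x.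
Proof. by rewrite nrmZ normc_def /= expr0n addr0 sqrtr_sqr. Qed.

Lemma nrmZi x : nrm ('i *: x) = nrm x.
Proof. by rewrite nrmZ normCi mul1r. Qed.

Lemma nrmM x y : nrm (x * y) <= nrm x * nrm y.
Proof. by rewrite -lecR rmorphM /= -!normE; exact: cstar_normM. Qed.

Lemma nrm_starM x : nrm (star x * x) = nrm x ^+ 2.
Proof. by apply: complexI; rewrite rmorphXn /= -!normE; exact: cstar_identity. Qed.

Lemma starD x y : star (x + y) = star x + star y.
Proof. exact: cstar_starD. Qed.

Lemma starZ k x : star (k *: x) = k^* *: star x.
Proof. exact: cstar_starZ. Qed.

Lemma starM x y : star (x * y) = star y * star x.
Proof. exact: cstar_starM. Qed.

Lemma starK x : star (star x) = x.
Proof. exact: cstar_starK. Qed.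

Lemma starN x : star (- x) = - star x.
Proof. by rewrite -scaleN1r starZ rmorphN rmorph1 scaleN1r. Qed.

Lemma starB x y : star (x - y) = star x - star y.
Proof. by rewrite starD starN. Qed.

Lemma star0 : star (0 : A) = 0.
Proof. by have := starB 0 0; rewrite !subrr. Qed.

Lemma star1 : star (1 : A) = 1.
Proof. by have := starM 1 (star 1); rewrite mul1r starK mul1r. Qed.

Lemma starZr r x : star (r *r x) = r *r star x.
Proof.
by rewrite starZ; congr (_ *: _); exact: conjc_real.
Qed.

Lemma starZi x : star ('i *: x) = - ('i *: star x).
Proof. by rewrite starZ conjCi scaleNr. Qed.

Lemma scAl k x y : (k *: x) * y = k *: (x * y).
Proof. by rewrite [RHS](@cstar_scaleAl R A). Qed.

Lemma scAr k x y : x * (k *: y) = k *: (x * y).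
Proof. by rewrite [RHS](@cstar_scaleAr R A). Qed.

Lemma nrm_star x : nrm (star x) = nrm x.
Proof.
suff le y : nrm y <= nrm (star y).
  by apply/le_anti; rewrite le -{2}(starK x) le.
have [->|/nrm_gt0 y0] := pselect (y = 0); first by rewrite nrm0 nrm_ge0.
have := nrmM (star y) y; rewrite nrm_starM expr2.
by rewrite ler_pM2r.
Qed.

(** From |1|^2 = |1|. Equality fails in the zero algebra, so estimates on scalars are kept
    one-sided. *)
Lemma nrm1_le : nrm (1 : A) <= 1.
Proof.
have := nrm_starM 1; rewrite star1 mulr1 => h.
have := nrm_ge0 (1 : A); nra.
Qed.

Lemma open_ball (G : set A) x : open G -> G x ->
  exists2 e : R, 0 < e & forall y, nrm (y - x) < e -> G y.
Proof.
rewrite openE => oG /oG /nbhs_ballP[e /= e0 eG].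
have er : e = (complex.Re e)%:C%C by rewrite RRe_real // gtr0_real.
exists (complex.Re e); first by rewrite -ltcR -er.
move=> y yx; apply: eG; rewrite -ball_normE /= distrC.
by rewrite normE er ltcR.
Qed.

(** The bounded increasing majorant [q] forces [u] to be Cauchy. Comparing increments lets one
    statement serve both the geometric series and the square root iteration. *)
Lemma complete_seq (u : nat -> A) (q : nat -> R) (M : R) :
  (forall n, nrm (u n.+1 - u n) <= q n.+1 - q n) -> (forall n, q n <= M) ->
  exists l, forall e, 0 < e -> exists N, forall n, (N <= n)%N -> nrm (u n - l) < e.
Proof.
move=> uq qM.
have qh : {homo q : m n / (m <= n)%N >-> m <= n}.
  apply/nondecreasing_seqP => n; rewrite -subr_ge0.
  by apply: le_trans (uq n); rewrite nrm_ge0.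
have umn m n : (m <= n)%N -> nrm (u n - u m) <= q n - q m.
  move=> /subnK <-; elim: (n - m)%N => [|k ih]; first by rewrite !subrr nrm0.
  rewrite addSn; apply: le_trans (nrm_triangle (u (k + m)%N) _ _) _.
  have := uq (k + m)%N; lra.
have hs : has_sup (range q).
  by split; [exists (q 0%N); exists 0%N|exists M => _ [n _ <-]].
have qS n : q n <= sup (range q).
  by apply: sup_upper_bound => //; exists n.
have cu : cvg (u @ \oo).
  apply/cauchy_cvgP/cauchyP => eps eps0.
  have er : eps = (complex.Re eps)%:C%C by rewrite RRe_real // gtr0_real.
  have e0 : 0 < complex.Re eps by rewrite -ltcR -er.
  have [_ [N _ <-] qN] := sup_adherent e0 hs.
  exists (u N), N => // n /= Nn.
  rewrite -ball_normE /= distrC normE er ltcR.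
  by have := umn _ _ Nn; have := qS n; lra.
have /cvg_ex[l ul] := cu.
exists l => e e0.
have [|N _ Nu] := @cvgr_distC_lt _ _ _ _ _ _ _ ul e%:C%C; first by rewrite ltcR.
by exists N => n /Nu /=; rewrite normE ltcR.
Qed.

End RealNorm.

(** * Inverses and square roots *)

Section Elementary.
Variables (R : realType) (A : cstarAlg R).
Implicit Types (x y z h c : A) (k : R[i]) (r s : R).

Definition tends (u : nat -> A) (l : A) :=
  forall e : R, 0 < e -> exists N, forall n, (N <= n)%N -> nrm (u n - l) < e.

Lemma small_eq0 x (C : R) : (forall e, 0 < e -> nrm x <= C * e) -> x = 0.
Proof.
move=> h; apply: nrm_eq0; apply/le_anti; rewrite nrm_ge0 andbT.
apply/ler_addgt0Pl => e e0; rewrite addr0.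
have C0 : 0 < `|C| + 1 by rewrite ltr_wpDl.
have /h : 0 < e / (`|C| + 1) by rewrite divr_gt0.
move=> /le_trans; apply; rewrite mulrCA ger_pMr // ler_pdivrMr // mul1r.
by rewrite (le_trans (ler_norm _)) // lerDl.
Qed.

Lemma tends_comm u l z : tends u l -> (forall n, z * u n = u n * z) -> z * l = l * z.
Proof.
move=> ul uz; apply/eqP; rewrite -subr_eq0; apply/eqP.
apply: (@small_eq0 _ (nrm z + nrm z)) => e /ul[N /(_ N (leqnn N)) uN].
have -> : z * l - l * z = (u N - l) * z - z * (u N - l).
  by rewrite mulrBl mulrBr uz; ncring.
apply: le_trans (nrmB _ _) _.
have := nrmM (u N - l) z; have := nrmM z (u N - l).
by have := nrm_ge0 z; have := nrm_ge0 (u N - l); nra.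
Qed.

Lemma tends_star u l : tends u l -> (forall n, star (u n) = u n) -> star l = l.
Proof.
move=> ul us; apply/eqP; rewrite -subr_eq0; apply/eqP.
apply: (@small_eq0 _ 2) => e /ul[N /(_ N (leqnn N)) uN].
have -> : star l - l = (u N - l) - star (u N - l) by rewrite starB us; ncring.
by apply: le_trans (nrmB _ _) _; rewrite nrm_star; lra.
Qed.

Lemma tends_nrm u l (M : R) : tends u l -> (forall n, nrm (u n) <= M) -> nrm l <= M.
Proof.
move=> ul uM; apply/ler_addgt0Pl => e /ul[N /(_ N (leqnn N)) uN].
have := uM N; have := nrmD (l - u N) (u N); rewrite subrK nrm_distC; lra.
Qed.

Lemma invertible1 : invertibles (1 : A).
Proof. by exists 1; split; rewrite mulr1. Qed.

Lemma invertibleM x y : invertibles x -> invertibles y -> invertibles (x * y).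
Proof.
move=> [x' [xx' x'x]] [y' [yy' y'y]]; exists (y' * x'); split.
  by rewrite mulrA -(mulrA x) yy' mulr1.
by rewrite mulrA -(mulrA y') x'x mulr1.
Qed.

Lemma invertibleZ k x : k != 0 -> invertibles x -> invertibles (k *: x).
Proof.
move=> k0 [x' [xx' x'x]]; exists (k^-1 *: x').
by split; rewrite scAl scAr scalerA ?xx' ?x'x (mulfV, mulVf) // scale1r.
Qed.

(** If z inverts x y, then y commutes with z, and [y * z] is a two-sided inverse of x. *)
Lemma invertible_comm x y : x * y = y * x -> invertibles (x * y) -> invertibles x.
Proof.
move=> xy [z [h1 h2]].
have h3 : y * z = z * y.
  have e : z * (x * y) * (y * z) = z * (y * (x * y * z)).
    have -> : y * (x * y * z) = (y * x) * (y * z) by ncring.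
    by rewrite -xy; ncring.
  by move: e; rewrite h2 mul1r h1 mulr1.
by exists (y * z); split; [rewrite mulrA|rewrite h3 -mulrA -xy].
Qed.

Lemma neumann x : nrm x < 1 -> invertibles (1 - x).
Proof.
move=> x1; have x0 := nrm_ge0 x.
(* [u n] is the partial sum of the powers of x in Horner form, [q n] the geometric sum for
   [nrm x]. *)
pose u := fix u n : A := if n is n'.+1 then 1 + x * u n' else 0.
pose q n : R := (1 - nrm x ^+ n) / (1 - nrm x).
have r0 : 0 < 1 - nrm x by lra.
have qS n : q n.+1 - q n = nrm x ^+ n.
  by rewrite /q exprS; field; rewrite gt_eqF.
have uS n : nrm (u n.+1 - u n) <= q n.+1 - q n.
  rewrite qS; elim: n => [|n ih].
    by rewrite expr0 /= mulr0 addr0 subr0 nrm1_le.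
  have -> : u n.+2 - u n.+1 = x * (u n.+1 - u n) by rewrite /=; ncring.
  by apply: le_trans (nrmM _ _) _; rewrite exprS ler_wpM2l.
have qM n : q n <= (1 - nrm x)^-1.
  rewrite /q ler_pdivrMr // mulVf ?gt_eqF // gerBl.
  by rewrite exprn_ge0.
have [l ul] := complete_seq uS qM.
have lE : l - (1 + x * l) = 0.
  apply: (@small_eq0 _ 2) => e /ul[N uN].
  have a := uN _ (leqnn N); have b := uN _ (leqnSn N).
  have -> : l - (1 + x * l) = x * (u N - l) - (u N.+1 - l) by rewrite /=; ncring.
  apply: le_trans (nrmB _ _) _.
  by have := nrmM x (u N - l); have := nrm_ge0 (u N - l); nra.
have lx : x * l = l * x.
  apply: (tends_comm ul); elim => [|n ih] /=; first by rewrite mulr0 mul0r.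
  by rewrite mulrDr mulrDl mulr1 mul1r -mulrA -ih.
exists l; split.
  by rewrite mulrBl mul1r; apply/eqP; rewrite subr_eq -subr_eq0 lE.
by rewrite mulrBr mulr1 -lx; apply/eqP; rewrite subr_eq -subr_eq0 lE.
Qed.

Definition rc r : A := r *r (1 : A).

Lemma rcl r x : rc r * x = r *r x.
Proof. by rewrite scAl mul1r. Qed.

Lemma rcr r x : x * rc r = r *r x.
Proof. by rewrite scAr mulr1. Qed.

Lemma rcC r x : x * rc r = rc r * x.
Proof. by rewrite rcl rcr. Qed.

Lemma rcD r s : rc (r + s) = rc r + rc s.
Proof. by rewrite /rc rmorphD scalerDl. Qed.

Lemma rcB r s : rc (r - s) = rc r - rc s.
Proof. by rewrite /rc rmorphB scalerBl. Qed.

Lemma rcM r s : rc (r * s) = rc r * rc s.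
Proof. by rewrite rcl /rc scalerA -rmorphM. Qed.

Lemma rc1 : rc 1 = 1.
Proof. by rewrite /rc scale1r. Qed.

Lemma rc0 : rc 0 = 0.
Proof. by rewrite /rc scale0r. Qed.

Lemma star_rc r : star (rc r) = rc r.
Proof. by rewrite starZr star1. Qed.

Lemma nrm_rc r : nrm (rc r) <= `|r|.
Proof. by rewrite nrmZr ler_piMr ?nrm1_le. Qed.

Lemma real_complex_neq0 r : r != 0 -> r%:C%C != 0 :> R[i].
Proof. by move=> r0; rewrite eq_complex /= eqxx andbT. Qed.

Lemma scaleKr r x : r != 0 -> r *r (r^-1 *r x) = x.
Proof. by move=> r0; rewrite scalerA -rmorphM mulfV // scale1r. Qed.

Lemma scale2r x : 2 *r x = x + x.
Proof. by rewrite rmorph_nat scaler_nat mulr2n. Qed.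

Lemma scale_half x : 2^-1 *r (x + x) = x.
Proof. by rewrite -scale2r scalerA -rmorphM mulVf ?scale1r ?pnatr_eq0. Qed.

Lemma neumannZ s x : nrm x < s -> invertibles (rc s - x).
Proof.
move=> xs; have s0 : 0 < s := le_lt_trans (nrm_ge0 x) xs.
have -> : rc s - x = s *r (1 - s^-1 *r x).
  by rewrite scalerBr scaleKr ?gt_eqF.
apply: invertibleZ; first by rewrite real_complex_neq0 ?gt_eqF.
apply: neumann.
by rewrite nrmZr ger0_norm ?invr_ge0 ?ltW // mulrC ltr_pdivrMr // mul1r.
Qed.

(* Iterate y |-> (x + y^2) / 2 from 0; the increments are dominated by those of
   the same iteration for x = 1 in R. *)
Lemma csqrt x : star x = x -> nrm x <= 1 ->
  exists y, [/\ star y = y, nrm y <= nrm x, (1 - y) * (1 - y) = 1 - x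
    & forall z, z * x = x * z -> z * y = y * z].
Proof.
move=> xs x1; have x0 := nrm_ge0 x.
pose u := fix u n : A := if n is n'.+1 then 2^-1 *r (x + u n' * u n') else 0.
pose q := fix q n : R := if n is n'.+1 then 2^-1 * (1 + q n' * q n') else 0.
have q01 n : 0 <= q n <= 1.
  by elim: n => [|n /andP[? ?]] /=; first lra; apply/andP; split; nra.
have uq n : nrm (u n) <= q n.
  elim: n => [|n ih] /=; first by rewrite nrm0.
  rewrite nrmZr ger0_norm ?invr_ge0 // ler_pM2l ?invr_gt0 //.
  apply: le_trans (nrmD _ _) _; apply: lerD => //.
  by apply: le_trans (nrmM _ _) _; rewrite ler_pM ?nrm_ge0.
have ux n : nrm (u n) <= nrm x.
  elim: n => [|n ih] /=; first by rewrite nrm0.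
  rewrite nrmZr ger0_norm ?invr_ge0 // mulrC ler_pdivrMr //.
  apply: le_trans (nrmD _ _) _; have := nrmM (u n) (u n).
  by have := nrm_ge0 (u n); nra.
have uc z : z * x = x * z -> forall n, z * u n = u n * z.
  move=> zx; elim=> [|n ih] /=; first by rewrite mulr0 mul0r.
  by rewrite scAr scAl mulrDr mulrDl zx mulrA ih -!mulrA ih.
have us n : star (u n) = u n.
  elim: n => [|n ih] /=; first exact: star0.
  by rewrite starZr starD starM ih xs.
have xu n : x * u n = u n * x by exact: uc.
have uu m n : u m * u n = u n * u m by apply: uc; rewrite xu.
have uS n : nrm (u n.+1 - u n) <= q n.+1 - q n.
  elim: n => [|n ih].
    rewrite /= !mulr0 !addr0 !subr0 nrmZr ger0_norm ?invr_ge0 //.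
    by rewrite mulr1 mulrC ler_pdivrMr // mulVf.
  have -> : u n.+2 - u n.+1 = 2^-1 *r ((u n.+1 - u n) * (u n.+1 + u n)).
    transitivity (2^-1 *r (x + u n.+1 * u n.+1) - 2^-1 *r (x + u n * u n)) => //.
    rewrite -scalerBr; congr (_ *: _).
    rewrite mulrBl !mulrDr (uu n n.+1); ncring.
  have -> : q n.+2 - q n.+1 = 2^-1 * ((q n.+1 - q n) * (q n.+1 + q n)).
    transitivity (2^-1 * (1 + q n.+1 * q n.+1) - 2^-1 * (1 + q n * q n)) => //.
    by ring.
  rewrite nrmZr ger0_norm ?invr_ge0 // ler_pM2l ?invr_gt0 //.
  apply: le_trans (nrmM _ _) _; rewrite ler_pM ?nrm_ge0 //.
  by apply: le_trans (nrmD _ _) _; rewrite lerD.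
have [|y uy] := complete_seq uS (M := 1); first by move=> n; case/andP: (q01 n).
have yc z : z * x = x * z -> z * y = y * z by move=> zx; exact: tends_comm (uc z zx).
have y1 : nrm y <= nrm x by exact: tends_nrm ux.
have yE : y = 2^-1 *r (x + y * y).
  apply/eqP; rewrite -subr_eq0; apply/eqP.
  apply: (@small_eq0 _ 2) => e /uy[N uN].
  have a := uN _ (leqnn N); have b := uN _ (leqnSn N).
  have -> : y - 2^-1 *r (x + y * y) =
    2^-1 *r ((u N - y) * (u N + y)) - (u N.+1 - y).
    rewrite [u N.+1]/=.
    have -> : (u N - y) * (u N + y) = (x + u N * u N) - (x + y * y).
      rewrite mulrBl !mulrDr (_ : y * u N = u N * y); first by ncring.
      by symmetry; apply: yc; rewrite xu.
    by rewrite scalerBr; ncring.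
  apply: le_trans (nrmB _ _) _; rewrite nrmZr ger0_norm ?invr_ge0 //.
  have := nrmM (u N - y) (u N + y); have := nrmD (u N) y; have := ux N.
  by have := nrm_ge0 (u N - y); have := nrm_ge0 (u N + y); nra.
exists y; split=> //; first by apply: tends_star uy _.
have : 2 *r y = x + y * y.
  by rewrite [in LHS]yE scaleKr ?pnatr_eq0.
rewrite scale2r => yy; rewrite !mulrBl !mulrBr !mul1r !mulr1.
have -> : 1 - y - (y - y * y) = 1 - (y + y) + y * y by ncring.
by rewrite yy; ncring.
Qed.

End Elementary.

(** * Self-adjoint and positive elements *)

Section Spectrum.
Variables (R : realType) (A : cstarAlg R).
Implicit Types (x y z h c : A) (k : R[i]) (r s : R).
Local Notation rc := (@rc R A).

Definition ii : A := 'i *: (1 : A).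

Lemma iil x : ii * x = 'i *: x.
Proof. by rewrite scAl mul1r. Qed.

Lemma iiC x : x * ii = ii * x.
Proof. by rewrite scAl scAr mulr1 mul1r. Qed.

Lemma ii_sq : ii * ii = -1.
Proof. by rewrite iil scalerA -expr2 sqrCi scaleN1r. Qed.

Lemma star_ii : star ii = - ii.
Proof. by rewrite starZi star1. Qed.

Lemma nrm_ii x : nrm (ii * x) = nrm x.
Proof. by rewrite iil nrmZi. Qed.

Lemma iiK x : ii * (ii * x) = - x.
Proof. by rewrite mulrA ii_sq mulN1r. Qed.

Definition reP x : A := 2^-1 *r (x + star x).
Definition imP x : A := 2^-1 *r (ii * (star x - x)).

Lemma star_reP x : star (reP x) = reP x.
Proof. by rewrite starZr starD starK addrC. Qed.

Lemma star_imP x : star (imP x) = imP x.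
Proof.
rewrite starZr starM starB starK star_ii mulrN iiC.
by congr (_ *: _); ncring.
Qed.

Lemma re_imE x : x = reP x + ii * imP x.
Proof.
rewrite /reP /imP scAr iiK -scalerDr.
by rewrite (_ : x + star x + _ = x + x) ?scale_half //; ncring.
Qed.

Lemma nrm_reP x : nrm (reP x) <= nrm x.
Proof.
rewrite nrmZr ger0_norm ?invr_ge0 // mulrC ler_pdivrMr //.
by apply: le_trans (nrmD _ _) _; rewrite nrm_star; lra.
Qed.

Lemma nrm_imP x : nrm (imP x) <= nrm x.
Proof.
rewrite nrmZr nrm_ii ger0_norm ?invr_ge0 // mulrC ler_pdivrMr //.
by apply: le_trans (nrmB _ _) _; rewrite nrm_star; lra.
Qed.

Lemma star_cart h c : star h = h -> star c = c -> star (h + ii * c) = h - ii * c.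
Proof. by move=> hs cs; rewrite starD starM star_ii hs cs mulrN iiC. Qed.

Lemma cartM h c h' c' :
  (h + ii * c) * (h' + ii * c') = (h * h' - c * c') + ii * (h * c' + c * h').
Proof.
rewrite mulrDl !mulrDr -!mulrA.
rewrite (mulrA h ii) iiC (mulrA c ii) iiC -!mulrA iiK; ncring.
Qed.

Lemma cart_starM h c : star h = h -> star c = c ->
  star (h + ii * c) * (h + ii * c) = (h * h + c * c) + ii * (h * c - c * h).
Proof.
move=> hs cs; rewrite star_cart // -mulrN cartM; congr (_ + _ * _); ncring.
Qed.

Lemma cart_Mstar h c : star h = h -> star c = c ->
  (h + ii * c) * star (h + ii * c) = (h * h + c * c) + ii * (c * h - h * c).
Proof.
move=> hs cs; rewrite star_cart // -mulrN cartM; congr (_ + _ * _); ncring.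
Qed.

Lemma reP_cart h c : star h = h -> star c = c -> reP (h + ii * c) = h.
Proof.
move=> hs cs; rewrite /reP star_cart // (_ : _ + _ = h + h) ?scale_half //; ncring.
Qed.

Lemma imP_cart h c : star h = h -> star c = c -> imP (h + ii * c) = c.
Proof.
move=> hs cs; rewrite /imP star_cart // (_ : _ - _ = - (ii * c) - (ii * c)); last ncring.
by rewrite mulrBr mulrN iiK opprK scale_half.
Qed.

(** By commutation, h + i c has squared norm |r 1| <= r, and h is its real part. *)
Lemma circle_nrm h c r : star h = h -> star c = c -> h * c = c * h ->
  h * h + c * c = rc r -> 0 <= r -> nrm h ^+ 2 <= r.
Proof.
move=> hs cs hc hr r0.
have := nrm_starM (h + ii * c); rewrite cart_starM // hr hc subrr mulr0 addr0.
have := nrm_rc A r; rewrite ger0_norm // => h1 h2.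
apply: le_trans h1; rewrite h2 ler_pXn2r ?nnegrE ?nrm_ge0 //.
by have := nrm_reP (h + ii * c); rewrite reP_cart.
Qed.

(** Here c is the square root of 1 - h^2, so that h + i c is unitary. The bound on 1 - c is of
    second order in h and keeps c + i h close to 1 for small h. *)
Lemma cos_sin h : star h = h -> nrm h <= 1 ->
  exists c, [/\ star c = c, h * h + c * c = 1, nrm (1 - c) <= nrm (h * h)
    & forall z, z * (h * h) = (h * h) * z -> z * c = c * z].
Proof.
move=> hs h1; have [||y [ys yn yE yc]] := @csqrt _ _ (h * h).
- by rewrite starM hs.
- by have := nrmM h h; have := nrm_ge0 h; nra.
exists (1 - y); split.
- by rewrite starB star1 ys.
- by rewrite yE; ncring.
- by rewrite (_ : 1 - (1 - y) = y) //; ncring.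
- by move=> z /yc zy; rewrite mulrBl mulrBr zy mulr1 mul1r.
Qed.

Lemma nrm_1Bsq h : star h = h -> nrm h <= 1 -> nrm (1 - h * h) <= 1.
Proof.
move=> hs h1; have [c [cs hc _ cc]] := cos_sin hs h1.
have ch : h * c = c * h by apply: cc; rewrite mulrA.
have -> : 1 - h * h = star c * c by rewrite -hc cs; ncring.
rewrite nrm_starM; apply: (@circle_nrm c h) => //.
by rewrite rc1 -hc addrC.
Qed.

Lemma nrm_rcBsq h s : star h = h -> nrm h ^+ 2 <= s -> nrm (rc s - h * h) <= s.
Proof.
move=> hs h1; have s0 : 0 <= s by apply: le_trans h1; rewrite exprn_ge0 ?nrm_ge0.
have [s00|s00] := eqVneq s 0.
  move: h1; rewrite s00 => h1.
  have h0 : nrm h = 0 by have := nrm_ge0 h; nra.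
  by rewrite (nrm_eq0 h0) mul0r rc0 subr0 nrm0.
have sp : 0 < s by rewrite lt_neqAle eq_sym s00.
pose t := Num.sqrt s; have t0 : 0 < t by rewrite sqrtr_gt0.
have tt : t * t = s by rewrite -expr2 sqr_sqrtr.
pose g := t^-1 *r h.
have hg : h = t *r g by rewrite scaleKr ?gt_eqF.
have -> : rc s - h * h = s *r (1 - g * g).
  by rewrite hg scAl scAr scalerA -rmorphM tt scalerBr.
rewrite nrmZr ger0_norm // ler_piMr // nrm_1Bsq //.
  by rewrite starZr hs.
rewrite nrmZr gtr0_norm ?invr_gt0 // (mulrC t^-1) ler_pdivrMr // mul1r.
by have := nrm_ge0 h; rewrite -tt in h1; nra.
Qed.

(** Squares have no negative spectrum: r + h^2 differs from the scalar r + |h|^2 by an element of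
    norm at most |h|^2, so the Neumann series applies. *)
Lemma invertible_rcDsq r h : 0 < r -> star h = h -> invertibles (rc r + h * h).
Proof.
move=> r0 hs.
have -> : rc r + h * h = rc (r + nrm h ^+ 2) - (rc (nrm h ^+ 2) - h * h).
  by rewrite rcD; ncring.
apply: neumannZ; apply: le_lt_trans (nrm_rcBsq hs (lexx _)) _; lra.
Qed.

(* Write 1 - h^2 = c^2 with c invertible; then c^2 - d = e^2 for some d > 0, so
   h^2 + e^2 = 1 - d and h + i e has norm at most sqrt (1 - d) < 1. *)
Lemma spectrum_unit h : star h = h -> nrm h = 1 ->
  invertibles (1 - h) -> invertibles (1 + h) -> False.
Proof.
move=> hs h1 i1 i2.
have [|c [cs hc _ cc]] := cos_sin hs; first by rewrite h1.
have ch : h * c = c * h by apply: cc; rewrite mulrA.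
have [w [cw wc]] : invertibles c.
  apply: (@invertible_comm _ _ c c) => //.
  have -> : c * c = (1 - h) * (1 + h).
    have -> : c * c = (h * h + c * c) - h * h by ncring.
    by rewrite hc; ncring.
  exact: invertibleM.
have ws : star w = w.
  have : star w * c = 1 by rewrite -{1}cs -starM cw star1.
  by move=> e; rewrite -[LHS]mulr1 -cw mulrA e mul1r.
have wcomm z : z * c = c * z -> z * w = w * z.
  move=> zc; rewrite -[z * w]mul1r -wc -!mulrA (mulrA c) -zc.
  by rewrite -(mulrA z) cw mulr1.
pose d := (nrm w ^+ 2 + 1)^-1.
have d0 : 0 < nrm w ^+ 2 + 1 by rewrite ltr_wpDl ?sqr_ge0.
have dp : 0 < d by rewrite invr_gt0.
pose x := rc d * (w * w).
have xw z : z * w = w * z -> z * x = x * z.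
  by move=> zw; rewrite /x mulrA rcC -!mulrA (mulrA z) zw -!mulrA zw.
have [||y [ys _ yE yc]] := @csqrt _ _ x.
- by rewrite /x rcl starZr starM ws.
- rewrite /x rcl nrmZr gtr0_norm // mulrC ler_pdivrMr // mul1r.
  by apply: le_trans (nrmM _ _) _; rewrite -expr2; lra.
pose e := (1 - y) * c.
have yC z : z * c = c * z -> z * (1 - y) = (1 - y) * z.
  by move=> zc; rewrite mulrBl mulrBr mulr1 mul1r yc //; apply/xw/wcomm.
have es : star e = e by rewrite starM cs starB star1 ys yC.
have he : h * e = e * h by rewrite /e mulrA yC // -!mulrA ch.
have ee : e * e = c * c - rc d.
  rewrite /e mulrA -(mulrA (1 - y)) yC // !mulrA yE.
  rewrite -mulrA mulrBl mul1r; congr (_ - _).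
  by rewrite /x -!mulrA (mulrA w c) wc mul1r wc mulr1.
have := @circle_nrm h e (1 - d) hs es he; rewrite ee rcB rc1 -hc.
have d1 : d <= 1 by rewrite invf_le1 // lerDr sqr_ge0.
by rewrite h1 expr1n => /(_ (addrA _ _ _)); lra.
Qed.

Lemma spectrum_sa h : star h = h -> h <> 0 ->
  invertibles (rc (nrm h) - h) -> invertibles (rc (nrm h) + h) -> False.
Proof.
move=> hs h0; have r0 := nrm_gt0 h0; set r := nrm h in r0 *.
pose g := r^-1 *r h.
have hg : h = r *r g by rewrite scaleKr ?gt_eqF.
have rV : (r^-1)%:C%C != 0 :> R[i] by rewrite real_complex_neq0 ?invr_eq0 ?gt_eqF.
move=> /(invertibleZ rV) + /(invertibleZ rV).
rewrite scalerBr scalerDr -/g /rc scalerA -rmorphM mulVf ?gt_eqF // scale1r.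
apply: spectrum_unit; first by rewrite starZr hs.
by rewrite nrmZr gtr0_norm ?invr_gt0 // mulVf ?gt_eqF.
Qed.

(** If both norms were smaller, Neumann series around the scalar s + |h| would invert |h| - h and
    |h| + h, against [spectrum_sa]. *)
Lemma shift_sa h s : star h = h -> h <> 0 ->
  s + nrm h <= nrm (rc s + h) \/ s + nrm h <= nrm (rc s - h).
Proof.
move=> hs h0; apply/orP; rewrite !leNgt -negb_and; apply/negP => /andP[h1 h2].
apply: (spectrum_sa hs h0).
  have -> : rc (nrm h) - h = rc (s + nrm h) - (rc s + h) by rewrite rcD; ncring.
  exact: neumannZ.
have -> : rc (nrm h) + h = rc (s + nrm h) - (rc s - h) by rewrite rcD; ncring.
exact: neumannZ.
Qed.

End Spectrum.

(** * Positive elements and extreme points of the unit ball *)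

Section Positivity.
Variables (R : realType) (A : cstarAlg R).
Implicit Types (x y z h c p : A) (k : R[i]) (r s : R).
Local Notation rc := (@rc R A).

Lemma sa_sq_eq0 h : star h = h -> h * h = 0 -> h = 0.
Proof.
move=> hs hh; apply: nrm_eq0; have := nrm_starM h; rewrite hs hh nrm0.
by move=> /esym/eqP; rewrite sqrf_eq0 => /eqP.
Qed.

(** With z the inverse of r - x y, the element 1 + y z x inverts r - y x up to the factor r. *)
Lemma jacobson r x y : r != 0 ->
  invertibles (rc r - x * y) -> invertibles (rc r - y * x).
Proof.
move=> r0 [z [h1 h2]].
have i : invertibles (rc r) by apply: invertibleZ (invertible1 _); rewrite real_complex_neq0.
have e1 : (rc r - y * x) * (1 + y * z * x) = rc r.
  have -> : (rc r - y * x) * (1 + y * z * x)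
    = rc r + (rc r * y) * z * x - y * x * y * z * x - y * x by ncring.
  rewrite -rcC.
  have -> : rc r + y * rc r * z * x - y * x * y * z * x - y * x
    = rc r + y * ((rc r - x * y) * z) * x - y * x by ncring.
  by rewrite h1; ncring.
have e2 : (1 + y * z * x) * (rc r - y * x) = rc r.
  have -> : (1 + y * z * x) * (rc r - y * x)
    = rc r + y * z * (x * rc r) - y * z * x * y * x - y * x by ncring.
  rewrite rcC.
  have -> : rc r + y * z * (rc r * x) - y * z * x * y * x - y * x
    = rc r + y * (z * (rc r - x * y)) * x - y * x by ncring.
  by rewrite h2; ncring.
apply: (@invertible_comm _ _ _ (1 + y * z * x)); rewrite e1 ?e2 //.
Qed.

(** The norm criterion for positivity: sums are handled by the triangle inequality, and r + p for r
    > 0 by a Neumann series. *)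
Definition pos p := star p = p /\ exists2 K : R, 0 <= K & nrm (rc K - p) <= K.

Lemma pos_sq h : star h = h -> pos (h * h).
Proof.
move=> hs; split; first by rewrite starM hs.
exists (nrm h ^+ 2); first exact: sqr_ge0.
exact: nrm_rcBsq.
Qed.

Lemma posD p q : pos p -> pos q -> pos (p + q).
Proof.
move=> [ps [K K0 Kp]] [qs [L L0 Lq]]; split; first by rewrite starD ps qs.
exists (K + L); first exact: addr_ge0.
have -> : rc (K + L) - (p + q) = (rc K - p) + (rc L - q) by rewrite rcD; ncring.
by apply: le_trans (nrmD _ _) _; exact: lerD.
Qed.

Lemma invertible_rcDpos r p : 0 < r -> pos p -> invertibles (rc r + p).
Proof.
move=> r0 [ps [K K0 Kp]].
have -> : rc r + p = rc (r + K) - (rc K - p) by rewrite rcD; ncring.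
by apply: neumannZ; lra.
Qed.

(** Two successive square roots of the normalized h^2: [g] is the square root of the absolute value
    of h, so [g * g] is that absolute value, already written as a square. *)
Lemma abs_sa h : star h = h ->
  exists g, [/\ star g = g, (g * g) * (g * g) = h * h
    & forall z, z * h = h * z -> z * g = g * z].
Proof.
move=> hs.
have [->|h0] := pselect (h = 0).
  by exists 0; split=> [||z]; rewrite ?star0 ?mulr0 ?mul0r.
have r0 := nrm_gt0 h0; set r := nrm h in r0.
pose f : A := r^-1 *r h.
have hf : h = r *r f by rewrite scaleKr ?gt_eqF.
have fs : star f = f by rewrite starZr hs.
have f1 : nrm f = 1 by rewrite nrmZr gtr0_norm ?invr_gt0 // mulVf ?gt_eqF.
have fz z : z * h = h * z -> z * f = f * z by move=> zh; rewrite /f scAl scAr zh.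
clearbody f.
have [||y [ys yn yE yc]] := @csqrt _ _ (1 - f * f).
- by rewrite starB star1 starM fs.
- by apply: nrm_1Bsq => //; rewrite f1.
have [||y' [ys' _ yE' yc']] := @csqrt _ _ y => //.
  by apply: le_trans yn _; apply: nrm_1Bsq => //; rewrite f1.
pose t := Num.sqrt r.
have tt : t * t = r by rewrite -expr2 sqr_sqrtr ?ltW.
exists (t *r (1 - y')); split.
- by rewrite starZr starB star1 ys'.
- have sq z : (t *r z) * (t *r z) = r *r (z * z).
    by rewrite scAl scAr scalerA -rmorphM tt.
  have ff : 1 - (1 - f * f) = f * f by ncring.
  by rewrite sq yE' [in RHS]hf !scAl !scAr yE ff //.
- move=> z zh; rewrite scAl scAr; congr (_ *: _).
  have zf := fz _ zh.
  have zy : z * y = y * z.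
    by apply: yc; rewrite mulrBl mulrBr mulr1 mul1r mulrA zf -mulrA zf mulrA.
  by rewrite mulrBl mulrBr mulr1 mul1r (yc' _ zy).
Qed.

Lemma starM_add_Mstar x : star x * x + x * star x
  = (reP x * reP x + imP x * imP x) + (reP x * reP x + imP x * imP x).
Proof.
have hs := star_reP x; have cs := star_imP x.
have := cart_starM hs cs; have := cart_Mstar hs cs.
by rewrite -re_imE => -> ->; ncring.
Qed.

(* Kaplansky's argument, with [N] twice the negative part of [star a * a]: the
   elements [star b * b] = - k^2 and [b * star b] share their nonzero spectrum,
   but the latter is positive, so b = 0. *)
Lemma starM_sq a : exists2 g : A, star g = g & g * g = star a * a.
Proof.
set x := star a * a.
have xs : star x = x by rewrite starM starK.
have [g [gs gg gc]] := abs_sa xs; exists g => //.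
set m := g * g in gg *; pose N := m - x.
have gx : g * x = x * g by rewrite gc.
have mx : m * x = x * m by rewrite /m -mulrA gx mulrA gx mulrA.
have ms : star m = m by rewrite starM gs.
have Ns : star N = N by rewrite starB ms xs.
have xN : x * N = - (m * N) by rewrite !mulrBr -gg mx; ncring.
have xN' : x * N = N * x by rewrite mulrBr mulrBl mx.
have NN : N * N = m * N + m * N.
  by rewrite {1}/N mulrBl xN; ncring.
have gN : g * N = N * g by rewrite mulrBr mulrBl gx /m mulrA.
have mN : m * N = N * m by rewrite /m -mulrA gN mulrA gN mulrA.
pose k := m * N; have ks : star k = k by rewrite starM ms Ns -mN.
pose b := a * g * N.
have bb : star b * b = - (k * k).
  rewrite !starM gs Ns; rewrite (_ : _ * (a * g * N) = N * g * x * g * N); last first.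
    by rewrite /x; ncring.
  rewrite (_ : N * g * x * g * N = N * (g * x) * (g * N)); last ncring.
  rewrite gx (_ : N * (x * g) * (g * N) = (N * x) * (m * N)); last first.
    by rewrite /m; ncring.
  by rewrite -xN' xN mulNr.
pose f := b * star b.
(* [starM_add_Mstar] trades [b * star b] for a sum of squares minus [star b * b], and the latter is
   - k^2. *)
have fE : f = (reP b * reP b + imP b * imP b) + (reP b * reP b + imP b * imP b) + k * k.
  by rewrite -(starM_add_Mstar b) bb -/f; ncring.
have fp : pos f.
  by rewrite fE; do ?[apply: posD]; apply: pos_sq; rewrite ?star_reP ?star_imP.
have f0 : f = 0.
  apply: contrapT => f0; have n0 := nrm_gt0 f0; have fs := fp.1.
  apply: (spectrum_sa fs f0); last exact: invertible_rcDpos.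
  apply: jacobson; first by rewrite gt_eqF.
  by rewrite bb opprK; exact: invertible_rcDsq.
have b0 : star b = 0.
  apply: nrm_eq0; have := nrm_starM (star b); rewrite starK -/f f0 nrm0.
  by move=> /esym/eqP; rewrite sqrf_eq0 => /eqP.
have k0 : k = 0.
  apply: (sa_sq_eq0 ks); apply: oppr_inj; rewrite -bb b0 mul0r oppr0 //.
have N0 : N = 0 by apply: (sa_sq_eq0 Ns); rewrite NN -/k k0 addr0.
by apply/eqP; rewrite -subr_eq0; apply/eqP.
Qed.

(** Let W = [star w * w] have norm above 1. Then |W| - W = (|W| - 1) + e^2 is invertible, and so is
    |W| + W because W is a square by [starM_sq]; this contradicts [spectrum_sa]. *)
Lemma contraction_of_sq (w e : A) : star e = e -> star w * w + e * e = 1 -> nrm w <= 1.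
Proof.
move=> es we; rewrite leNgt; apply/negP => w1.
have [g gs gE] := starM_sq w; set W := star w * w in we gE.
have Ws : star W = W by rewrite starM starK.
have nW : nrm W = nrm w ^+ 2 by rewrite nrm_starM.
have s1 : 1 < nrm W by rewrite nW exprn_egt1.
apply: (spectrum_sa Ws).
- by move=> W0; move: s1; rewrite W0 nrm0 ltr10.
- have -> : rc (nrm W) - W = rc (nrm W - 1) + e * e.
    by rewrite rcB rc1 -we; ncring.
  by apply: invertible_rcDsq => //; lra.
- by rewrite -gE; apply: invertible_rcDsq => //; rewrite gE; lra.
Qed.

Lemma nrm_unitary (w : A) : unitary w -> nrm w <= 1.
Proof.
move=> [w1 _]; have := nrm_starM w; rewrite w1 => e.
by have := nrm1_le A; rewrite e; have := nrm_ge0 w; nra.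
Qed.

Lemma star_unitary (w : A) : unitary w -> unitary (star w).
Proof. by move=> [w1 w2]; split; rewrite starK. Qed.

Lemma unitary1 : unitary (1 : A).
Proof. by split; rewrite star1 mulr1. Qed.

Lemma nrm_unitaryM (w x : A) : unitary w -> nrm (w * x) = nrm x.
Proof.
move=> uw; have n1 := nrm_unitary uw; have n2 := nrm_unitary (star_unitary uw).
apply/le_anti/andP; split.
  by have := nrmM w x; have := nrm_ge0 x; nra.
have := nrmM (star w) (w * x); rewrite mulrA uw.1 mul1r.
by have := nrm_ge0 (w * x); nra.
Qed.

(** The real part of x vanishes by [shift_sa] at 1. Then x = i k and |1 + i k|^2 = |1 + k^2| <= 1,
    which makes |k^2| - k^2 invertible unless k = 0. *)
Lemma extreme1 x : nrm (1 + x) <= 1 -> nrm (1 - x) <= 1 -> x = 0.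
Proof.
move=> x1 x2; pose h := reP x; pose k := imP x.
have hs : star h = h := star_reP x; have ks : star k = k := star_imP x.
have h0 : h = 0.
  apply: contrapT => h0; have := nrm_gt0 h0.
  have a1 : nrm (1 + h) <= nrm (1 + x).
    rewrite (_ : 1 + h = reP (1 + x)) ?nrm_reP // {1}(re_imE x).
    by rewrite addrA reP_cart ?star_imP // starD star1 star_reP.
  have a2 : nrm (1 - h) <= nrm (1 - x).
    rewrite (_ : 1 - h = reP (1 - x)) ?nrm_reP // {1}(re_imE x).
    by rewrite opprD addrA -mulrN reP_cart // ?starN ?starB ?star1 ?star_imP ?star_reP.
  by have [] := shift_sa 1 hs h0; rewrite rc1; lra.
have xE : x = ii A * k by rewrite (re_imE x) -/h h0 add0r.
suff k0 : k = 0 by rewrite xE k0 mulr0.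
apply: contrapT => k0.
have kk0 : k * k <> 0 by move=> /(sa_sq_eq0 ks).
have kks : star (k * k) = k * k by rewrite starM ks.
have n0 := nrm_gt0 kk0.
apply: (spectrum_sa kks kk0); last exact: invertible_rcDsq.
have -> : rc (nrm (k * k)) - k * k = rc (1 + nrm (k * k)) - (1 + k * k).
  by rewrite rcD rc1; ncring.
apply: neumannZ.
have -> : 1 + k * k = star (1 + ii A * k) * (1 + ii A * k).
  by rewrite cart_starM ?star1 // !mul1r mulr1 subrr mulr0 addr0.
rewrite nrm_starM -xE; have := nrm_ge0 (1 + x); nra.
Qed.

Lemma extreme_unitary (w x : A) : unitary w ->
  nrm (w + x) <= 1 -> nrm (w - x) <= 1 -> x = 0.
Proof.
move=> uw; have uw' := star_unitary uw.
rewrite -(nrm_unitaryM _ uw') -(nrm_unitaryM (w - x) uw') mulrDr mulrBr uw.1.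
by move=> h1 /(extreme1 h1) e; rewrite -[x]mul1r -uw.2 -mulrA e mulr0.
Qed.

(* The perturbation v (1 - k) / 2 stays in the unit ball because of the identity
   t (3 - t)^2 / 4 + (1 - t)^2 (1 - t / 4) = 1. *)
Lemma unitary_of_extreme (v : A) : invertibles v -> nrm v <= 1 ->
  (forall y, nrm (v + y) <= 1 -> nrm (v - y) <= 1 -> y = 0) -> unitary v.
Proof.
move=> [v' [vv' v'v]] v1 ext; pose k := star v * v.
have v0 := nrm_ge0 v.
have ks : star k = k by rewrite starM starK.
have k1 : nrm k <= 1 by rewrite nrm_starM; nra.
suff kE : k = 1.
  split=> //; rewrite (_ : star v = v') //.
  by rewrite -[star v]mulr1 -vv' mulrA -/k kE mul1r.
suff : v * (1 - k) = 0.
  move=> /(congr1 (fun x => v' * x)); rewrite mulr0 mulrA v'v mul1r => /eqP.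
  by rewrite subr_eq0 => /eqP.
have n4 : 0 < 4%:R^-1 :> R by rewrite invr_gt0.
pose q : A := 4^-1 *r k.
have kq : k = q + q + q + q.
  rewrite -[LHS](@scaleKr _ _ 4) ?pnatr_eq0 // -/q.
  by rewrite rmorph_nat scaler_nat !mulrS mulr0n addr0 !addrA.
have qs : star q = q by rewrite starZr ks.
have [||y [ys _ yE yc]] := @csqrt _ _ q => //.
  by rewrite nrmZr gtr0_norm //; lra.
have yk : y * k = k * y.
  have yq : y * q = q * y by rewrite yc.
  by rewrite kq !mulrDl !mulrDr yq.
rewrite -[LHS]scale_half scalerDr; set t := 2^-1 *r _.
suff -> : t = 0 by rewrite addr0.
have tE : t + t = v * (1 - k) by rewrite -scalerDr scale_half.
apply: ext.
- pose w : A := 2^-1 *r (v * (1 + 1 + 1 - k)).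
  have -> : v + t = w.
    rewrite -[v]scale_half -scalerDr; congr (_ *: _); ncring.
  (* As (1 - y)^2 = 1 - k / 4, e^2 is the second summand of the identity at t = k, and [star w * w]
     the first. *)
  pose e := (1 - k) * (1 - y).
  have ec : (1 - k) * (1 - y) = (1 - y) * (1 - k).
    by rewrite !mulrBl !mulrBr yk; ncring.
  apply: (@contraction_of_sq w e).
    by rewrite starM !starB star1 ys ks -ec.
  have -> : e * e = (1 - k) * (1 - k) * (1 - q).
    rewrite (_ : e * e = (1 - k) * ((1 - y) * (1 - k)) * (1 - y)); last by rewrite /e; ncring.
    by rewrite -ec -yE; ncring.
  rewrite starZr starM scAl scAr scalerA -rmorphM -invfM -natrM.
  rewrite -mulrA (mulrA (star v)) -/k !starB !starD ks star1.
  rewrite -scAr -scAl -/q kq; ncring.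
- have -> : v - t = 2^-1 *r (v * (1 + k)).
    rewrite -{1}[v]scale_half -scalerBr; congr (_ *: _); ncring.
  rewrite nrmZr gtr0_norm ?invr_gt0 // mulrC ler_pdivrMr // mul1r.
  have := nrmM v (1 + k); have := nrmD 1 k; have := nrm1_le A; have := nrm_ge0 (1 + k).
  nra.
Qed.

End Positivity.

(** A surjective additive isometry preserves extreme points of the unit ball. Invertibility of the
    image is a hypothesis because an extreme point may fail to be unitary. *)
Lemma unitary_image (R : realType) (A B : cstarAlg R) (L : A -> B) (w : A) :
  (forall x y, L (x + y) = L x + L y) -> (forall x, nrm (L x) = nrm x) ->
  (forall y, exists x, L x = y) -> unitary w -> invertibles (L w) -> unitary (L w).
Proof.
move=> LD Liso Lsurj uw iw.
apply: unitary_of_extreme => //; first by rewrite Liso nrm_unitary.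
have L0 : L 0 = 0 by apply: nrm_eq0; rewrite Liso nrm0.
have LB x y : L (x - y) = L x - L y.
  by apply/eqP; rewrite eq_sym subr_eq -LD subrK.
move=> y; have [x <-] := Lsurj y; rewrite -LD -LB !Liso => h1 h2.
by rewrite (extreme_unitary uw h1 h2).
Qed.

(** * Real-linear isometries *)

Definition rl_isometry (R : realType) (A B : cstarAlg R) (L : A -> B) :=
  real_linear L /\ forall x, nrm (L x) = nrm x.

Section RealLinear.
Variables (R : realType) (A B : cstarAlg R) (L : A -> B).
Implicit Types (x y : A) (r : R).
Hypothesis HL : rl_isometry L.

Lemma rlD x y : L (x + y) = L x + L y. Proof. exact: HL.1.1. Qed.
Lemma rlZ r x : L (r *r x) = r *r L x. Proof. exact: HL.1.2. Qed.
Lemma rlI x : nrm (L x) = nrm x. Proof. exact: HL.2. Qed.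
Lemma rlN x : L (- x) = - L x.
Proof. by have := rlZ (-1) x; rewrite rmorphN !scaleNr !scale1r. Qed.
Lemma rlB x y : L (x - y) = L x - L y. Proof. by rewrite rlD rlN. Qed.
Lemma rl0 : L 0 = 0. Proof. by rewrite -(subrr (0 : A)) rlB subrr. Qed.
Lemma rl_inj x y : L x = L y -> x = y.
Proof.
move=> e; apply/eqP; rewrite -subr_eq0; apply/eqP/nrm_eq0.
by rewrite -rlI rlB e subrr nrm0.
Qed.

Lemma rl_inverse : (forall y : B, exists x, L x = y) ->
  exists2 M : B -> A, rl_isometry M & cancel M L /\ cancel L M.
Proof.
move=> /choice[M ML]; exists M; last by split=> // x; apply: rl_inj.
split; last by move=> x; rewrite -rlI ML.
by split=> [a b|r a]; apply: rl_inj; rewrite ?rlD ?rlZ !ML.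
Qed.

End RealLinear.

Lemma rl_unitary (R : realType) (A B : cstarAlg R) (L : A -> B) (w : A) :
  rl_isometry L -> (forall y, exists x, L x = y) -> unitary w ->
  invertibles (L w) -> unitary (L w).
Proof.
by move=> HL sL; apply: unitary_image => // *; [exact: (rlD HL)|exact: (rlI HL)].
Qed.

Lemma rl_comp (R : realType) (A B D : cstarAlg R) (L : A -> B) (M : B -> D) :
  rl_isometry L -> rl_isometry M -> rl_isometry (M \o L).
Proof.
move=> HL HM; split; last by move=> x /=; rewrite (rlI HM) (rlI HL).
by split=> [a b|r a] /=; rewrite ?(rlD HL) ?(rlZ HL) ?(rlD HM) ?(rlZ HM).
Qed.

Lemma rl_mul (R : realType) (A : cstarAlg R) (w : A) :
  unitary w -> rl_isometry (fun x => w * x).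
Proof.
move=> uw; split; last by move=> x; exact: nrm_unitaryM.
by split=> [a b|r a]; rewrite ?mulrDr // scAr.
Qed.

(** * Tangent directions to the unitary group *)

Section Tangent.
Variables (R : realType) (A : cstarAlg R).
Implicit Types (x y w h c : A) (r t C : R).

(** By [shift_sa], a nonzero real part h gives |1 + t x| >= 1 + |t| |h| for one of the signs of t:
    growth of first order. *)
Lemma tangent_reP0 x C :
  (forall t : R, nrm (1 + t *r x) ^+ 2 <= 1 + C * t ^+ 2) -> star x = - x.
Proof.
move=> H; suff h0 : reP x = 0.
  apply/eqP; rewrite -addr_eq0 addrC -(scale_half (x + star x)) scalerDr.
  by rewrite -/(reP x) h0 addr0.
set h := reP x; have hs : star h = h := star_reP x.
apply: contrapT => h0; have n0 := nrm_gt0 h0; set n := nrm h in n0.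
pose c := imP x; have cs : star c = c := star_imP x.
have reE t : nrm (1 + t *r h) <= nrm (1 + t *r x).
  have -> : 1 + t *r x = (1 + t *r h) + ii A * (t *r c).
    by rewrite {1}(re_imE x) scalerDr scAr addrA.
  have e1 : star (1 + t *r h) = 1 + t *r h by rewrite starD star1 starZr hs.
  have e2 : star (t *r c) = t *r c by rewrite starZr cs.
  by have := nrm_reP ((1 + t *r h) + ii A * (t *r c)); rewrite reP_cart.
have D0 : 0 < `|C| + 1 by rewrite ltr_wpDl.
(* Small enough that C t <= n, so the quadratic term C t^2 stays below the linear gain 2 t n. *)
pose t := n / (`|C| + 1).
have t0 : 0 < t by rewrite divr_gt0.
have tC : (`|C| + 1) * t = n by rewrite /t mulrC divfK ?gt_eqF.
have ths : star (t *r h) = t *r h by rewrite starZr hs.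
have th0 : t *r h <> 0.
  by move=> /(congr1 (@nrm _ _)); rewrite nrmZr nrm0 gtr0_norm // -/n; nra.
have tn : 1 + t * n <= nrm (1 + t *r x) \/ 1 + t * n <= nrm (1 + (- t) *r x).
  have := shift_sa 1 ths th0; rewrite nrmZr rc1 gtr0_norm // -/n.
  case=> le; [left|right]; apply: le_trans le _; first exact: reE.
  by have := reE (- t); rewrite rmorphN scaleNr.
have Ct : 1 + C * t ^+ 2 < (1 + t * n) ^+ 2.
  have : C * t <= n by have := ler_norm C; nra.
  by nra.
have tp : 0 <= 1 + t * n by nra.
have sq a : 1 + t * n <= nrm a -> (1 + t * n) ^+ 2 <= nrm a ^+ 2.
  by move=> le; rewrite ler_pXn2r ?nnegrE ?nrm_ge0.
case: tn => /sq; first by have := H t; lra.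
by have := H (- t); rewrite sqrrN; lra.
Qed.

Lemma skew_tangent x t : star x = - x ->
  nrm (1 + t *r x) ^+ 2 <= 1 + nrm x ^+ 2 * t ^+ 2.
Proof.
move=> xs; rewrite -nrm_starM starD star1 starZr xs scalerN.
have -> : (1 - t *r x) * (1 + t *r x) = 1 - (t *r x) * (t *r x) by ncring.
apply: le_trans (nrmB _ _) _; apply: lerD; first exact: nrm1_le.
apply: le_trans (nrmM _ _) _.
by rewrite -expr2 nrmZr exprMn real_normK ?num_real // mulrC.
Qed.

End Tangent.

(** That x is tangent to the unitary group at w means |w + t x|^2 <= 1 + O(t^2), a condition which L
    transports to [L w] and [L x]. *)
Lemma skew_transfer (R : realType) (A B : cstarAlg R) (L : A -> B) (w x : A) :
  rl_isometry L -> unitary w -> unitary (L w) ->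
  star (star w * x) = - (star w * x) ->
  star (star (L w) * L x) = - (star (L w) * L x).
Proof.
move=> HL uw uv sk; apply: (@tangent_reP0 _ _ _ (nrm (star w * x) ^+ 2)) => t.
rewrite -uv.1 -scAr -mulrDr nrm_unitaryM; last exact: star_unitary.
rewrite -(rlZ HL) -(rlD HL) (rlI HL) -(nrm_unitaryM _ (star_unitary uw)).
by rewrite mulrDr uw.1 scAr skew_tangent.
Qed.

Section ComplexLinear.
Variables (R : realType) (A B : cstarAlg R) (L : A -> B).
Implicit Types (x y h : A).
Hypotheses (HL : rl_isometry L) (L1 : L 1 = 1).

Lemma unital_skew x : star x = - x -> star (L x) = - L x.
Proof.
move=> xs; have u1 := unitary1 A.
have := @skew_transfer _ _ _ L 1 x HL u1; rewrite L1 !star1 !mul1r.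
by apply=> //; exact: unitary1.
Qed.

Hypothesis Li : L (ii A) = ii B.

Lemma unitary_ii (D : cstarAlg R) : unitary (ii D).
Proof. by split; rewrite star_ii ?mulNr ?mulrN ii_sq opprK. Qed.

(** The tangent directions at the unitary i are the self-adjoint elements. *)
Lemma unital_sa h : star h = h -> star (L h) = L h.
Proof.
move=> hs; have := @skew_transfer _ _ _ L (ii A) h HL (unitary_ii A).
rewrite Li => /(_ (unitary_ii B)).
rewrite !star_ii !mulNr !starN !starM !star_ii hs !mulrN !opprK !iiC.
move=> /(_ erefl) /(congr1 (fun z => ii B * z)); rewrite !iiK.
exact: oppr_inj.
Qed.

(* Skew directions are preserved at the unitaries 1, i and (3 + 4 i) / 5. *)
Lemma unital_ii_sa h : star h = h -> L (ii A * h) = ii B * L h.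
Proof.
move=> hs; set y := L h; set k := L (ii A * h).
have ys : star y = y by exact: unital_sa.
have ks : star k = - k by apply: unital_skew; rewrite starM star_ii hs mulrN iiC.
have iks : star (ii B * k) = ii B * k by rewrite starM star_ii ks mulrNN iiC.
have iys : star (ii B * y) = - (ii B * y) by rewrite starM star_ii ys mulrN iiC.
(* A rational point of the unit circle off both axes; only a^2 + b^2 = 1 and a b != 0 are kept. *)
pose a : R := 3 / 5; pose b : R := 4 / 5.
have ab : a * a + b * b = 1 by rewrite /a /b; field.
have ab0 : a * b <> 0 by rewrite /a /b; lra.
clearbody a b.
have wu (D : cstarAlg R) : unitary (rc D a + ii D * rc D b).
  split; rewrite ?cart_starM ?cart_Mstar ?star_rc //.
    by rewrite -!rcM (mulrC a b) subrr mulr0 addr0 -rcD ab rc1.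
  by rewrite -!rcM (mulrC a b) subrr mulr0 addr0 -rcD ab rc1.
have Lrc r : L (rc A r) = rc B r by rewrite (rlZ HL) L1.
have Lw : L (rc A a + ii A * rc A b) = rc B a + ii B * rc B b.
  by rewrite (rlD HL) Lrc rcC rcl (rlZ HL) Li -rcl -rcC.
have wx : star (rc A a + ii A * rc A b) * ((rc A a + ii A * rc A b) * (ii A * h)) = ii A * h.
  by rewrite mulrA (wu A).1 mul1r.
have := @skew_transfer _ _ _ L _ ((rc A a + ii A * rc A b) * (ii A * h)) HL (wu A).
rewrite wx Lw => /(_ (wu B)).
rewrite starM star_ii hs mulrN iiC => /(_ erefl).
have -> : (rc A a + ii A * rc A b) * (ii A * h) = a *r (ii A * h) - b *r h.
  by rewrite mulrDl rcl -mulrA rcl scAr iiK scalerN.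
rewrite (rlB HL) !(rlZ HL) -/k -/y star_cart ?star_rc //.
have -> : (rc B a - ii B * rc B b) * (a *r k - b *r y) =
    (a * a) *r k - (a * b) *r y - (a * b) *r (ii B * k) + (b * b) *r (ii B * y).
  rewrite mulrBl !mulrBr !rcl -!mulrA !rcl !scAr !scalerA !rmorphM /= (mulrC b%:C%C); ncring.
(* k and i y are skew, y and i k self-adjoint; the self-adjoint part - a b (y + i k) must vanish,
   that is k = i y. *)
rewrite starD !starB !starZr ks ys iks iys !scalerN => e.
have : (a * b) *r (y + ii B * k) = 0.
  rewrite -[LHS]scale_half; apply/eqP; rewrite scaler_eq0; apply/orP; right.
  rewrite scalerDr; move/eqP: e; rewrite -subr_eq0 => /eqP e; apply/eqP.
  by rewrite -[RHS]oppr0 -e; ncring.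
move=> /eqP; rewrite scaler_eq0 => /orP[/eqP/complexI/ab0 []|/eqP e0].
by move: (congr1 (fun z => ii B * z) e0); rewrite mulr0 mulrDr iiK => /eqP; rewrite subr_eq0 => /eqP ->.
Qed.

Lemma unital_ii x : L (ii A * x) = ii B * L x.
Proof.
have hs := star_reP x; have cs := star_imP x; rewrite (re_imE x).
by rewrite mulrDr iiK !(rlD HL) (rlN HL) !unital_ii_sa // mulrDr iiK.
Qed.

Lemma unital_star x : L (star x) = star (L x).
Proof.
have hs := star_reP x; have cs := star_imP x; rewrite {1}(re_imE x).
rewrite star_cart // [in RHS](re_imE x) (rlB HL) (rlD HL) unital_ii.
by rewrite star_cart // unital_sa.
Qed.

End ComplexLinear.

(** Being near i, s = L(i) is invertible, hence unitary; it is also skew, so s^2 = -1. Then p = 1 +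
    i s satisfies (2 - p) p = 0, and |p| < 1 makes 2 - p invertible. *)
Lemma near_ii (R : realType) (A : cstarAlg R) (L : A -> A) :
  rl_isometry L -> (forall y, exists x, L x = y) -> L 1 = 1 ->
  nrm (L (ii A) - ii A) < 1 -> L (ii A) = ii A.
Proof.
move=> HL sL L1; set s := L (ii A) => ns.
pose p := 1 + ii A * s.
have p1 : nrm p < 1.
  rewrite -(nrm_ii p) (_ : ii A * p = - (s - ii A)) ?nrmN //.
  by rewrite mulrDr mulr1 iiK opprB.
have si : invertibles s.
  have i1 : invertibles (1 - p) by exact: neumann.
  have -> : s = ii A * (1 - p) by rewrite mulrBr mulrDr mulr1 iiK; ncring.
  apply: invertibleM => //; exists (- ii A).
  by split; rewrite ?mulrN ?mulNr ii_sq opprK.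
have su : unitary s by exact: rl_unitary (unitary_ii A) si.
have ss : star s = - s by apply: unital_skew => //; exact: star_ii.
have s2 : s * s = -1 by rewrite -[RHS](congr1 -%R su.1) ss mulNr opprK.
have pp : (1 + 1 - p) * p = 0.
  rewrite (_ : (1 + 1 - p) * p = 1 - ii A * (s * ii A) * s); last by rewrite /p; ncring.
  by rewrite iiC iiK mulNr s2 opprK subrr.
have [q [_ qp]] : invertibles (1 + 1 - p).
  by have := @neumannZ _ _ (1 + 1) p; rewrite rcD rc1; apply; lra.
have p0 : p = 0 by rewrite -[p]mul1r -qp -mulrA pp mulr0.
have := congr1 (fun z => ii A * z) p0; rewrite mulr0 /p mulrDr mulr1 iiK => /eqP.
by rewrite subr_eq0 => /eqP.
Qed.

(** * Norms and the triple product *)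

Section Triple.
Variables (R : realType) (A B : cstarAlg R).

(** If a > b > 0, Bernoulli's inequality makes the powers of a / b unbounded. *)
Lemma le_of_pow (C a b : R) : 0 <= a -> 0 <= b ->
  (forall n, a ^+ (3 ^ n) <= C * b ^+ (3 ^ n)) -> a <= b.
Proof.
move=> a0 b0 H; rewrite leNgt; apply/negP => ba.
have [b00|bn0] := eqVneq b 0.
  by have := H 0%N; rewrite expn0 !expr1 b00 mulr0; lra.
have bp : 0 < b by rewrite lt_neqAle eq_sym bn0.
pose d := a / b - 1.
have d0 : 0 < d by rewrite subr_gt0 ltr_pdivlMr // mul1r.
have bern n : 1 + d *+ n <= (a / b) ^+ n.
  elim: n => [|n ih]; first by rewrite mulr0n addr0 expr0.
  rewrite exprS mulrS.
  have -> : a / b = 1 + d by rewrite /d; ring.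
  have := ih; rewrite (_ : a / b = 1 + d); last by rewrite /d; ring.
  have : 0 <= d *+ n by rewrite mulrn_wge0 ?ltW.
  nra.
have HC n : d * n%:R <= C.
  have := H n; have := bern (3 ^ n)%N; rewrite expr_div_n ler_pdivlMr ?exprn_gt0 // => h1 h2.
  have := le_trans h1 h2; rewrite ler_pM2r ?exprn_gt0 // => h3.
  have : d *+ n <= d *+ (3 ^ n).
    by rewrite -!(mulr_natr d) ler_pM2l // ler_nat ltnW // ltn_expl.
  by rewrite mulr_natr; lra.
have := archi_boundP (_ : 0 <= C / d).
have C0 : 0 <= C by have := HC 0%N; rewrite mulr0.
move=> /(_ (divr_ge0 C0 (ltW d0))); set N := Num.bound _.
by rewrite ltr_pdivrMr // => h; have := HC N; lra.
Qed.

(** Applying the C*-identity twice gives |y|^4 <= |y| |y y^* y|. *)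
Lemma nrm_triple_ge (D : cstarAlg R) (y : D) : nrm y ^+ 3 <= nrm (y * star y * y).
Proof.
have [->|/nrm_gt0 y0] := pselect (y = 0).
  by rewrite nrm0 expr0n nrm_ge0.
have : nrm (star y * y) ^+ 2 <= nrm y * nrm (y * star y * y).
  rewrite -nrm_starM starM starK -(nrm_star y).
  by rewrite -[X in nrm X]mulrA (mulrA y) nrmM.
rewrite nrm_starM -exprM (_ : (2 * 2)%N = 4%N) // exprS.
by rewrite ler_pM2l.
Qed.

(* The map x |-> x x^* x cubes norms, so a bound C improves to C^(1 / 3^n). *)
Lemma triple_contraction (f : A -> B) (C : R) :
  (forall x, f (x * star x * x) = f x * star (f x) * f x) ->
  (forall x, nrm (f x) <= C * nrm x) -> forall x, nrm (f x) <= nrm x.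
Proof.
move=> f3 fC x.
apply: (@le_of_pow `|C|) => [||n]; rewrite ?nrm_ge0 //.
elim: n x => [|n ih] x.
  rewrite expn0 !expr1; apply: le_trans (fC x) _.
  by rewrite ler_wpM2r ?nrm_ge0 // ler_norm.
rewrite expnS !exprM; apply: le_trans (le_trans _ (ih (x * star x * x))) _.
  by rewrite f3 lerXn2r ?nnegrE ?exprn_ge0 ?nrm_ge0 ?nrm_triple_ge.
apply: ler_wpM2l => //; rewrite lerXn2r ?nnegrE ?exprn_ge0 ?nrm_ge0 //.
apply: le_trans (nrmM _ _) _; rewrite !exprSr expr0 mul1r ler_wpM2r ?nrm_ge0 //.
by apply: le_trans (nrmM _ _) _; rewrite nrm_star.
Qed.

End Triple.

(** * The involution applied on one central summand *)

Section Mixing.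
Variables (R : realType) (B : cstarAlg R) (P : B).
Hypothesis HP : central_projection P.
Implicit Types (x y : B).

(** Identity on the summand of P, adjoint on the complement: an involutive map which respects the
    triple product, since the adjoint does. *)
Definition mix x : B := P * x + (1 - P) * star x.

Lemma projPP : P * P = P. Proof. by case: HP. Qed.
Lemma projC x : x * P = P * x. Proof. by case: HP => _ _ ->. Qed.
Lemma projPQ : P * (1 - P) = 0. Proof. by rewrite mulrBr mulr1 projPP subrr. Qed.
Lemma projQP : (1 - P) * P = 0. Proof. by rewrite mulrBl mul1r projPP subrr. Qed.
Lemma projQQ : (1 - P) * (1 - P) = 1 - P.
Proof. by rewrite mulrBr mulr1 projQP subr0. Qed.
Lemma projQC x : x * (1 - P) = (1 - P) * x.
Proof. by rewrite mulrBr mulrBl projC mulr1 mul1r. Qed.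
Lemma star_proj : star P = P. Proof. by case: HP. Qed.
Lemma star_projQ : star (1 - P) = 1 - P. Proof. by rewrite starB star1 star_proj. Qed.

Lemma proj_splitM x y x' y' :
  (P * x + (1 - P) * y) * (P * x' + (1 - P) * y') = P * (x * x') + (1 - P) * (y * y').
Proof.
rewrite mulrDl !mulrDr.
rewrite (_ : P * x * (P * x') = P * (x * P) * x'); last ncring.
rewrite (_ : P * x * ((1 - P) * y') = P * (x * (1 - P)) * y'); last ncring.
rewrite (_ : (1 - P) * y * (P * x') = (1 - P) * (y * P) * x'); last ncring.
rewrite (_ : (1 - P) * y * ((1 - P) * y') = (1 - P) * (y * (1 - P)) * y'); last ncring.
rewrite !projC !projQC !(mulrA P) !(mulrA (1 - P)) projPP projPQ projQP projQQ.
by rewrite !mul0r addr0 add0r.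
Qed.

Lemma star_split x y : star (P * x + (1 - P) * y) = P * star x + (1 - P) * star y.
Proof. by rewrite starD !starM star_proj star_projQ projC projQC. Qed.

Lemma mixK x : mix (mix x) = x.
Proof.
rewrite /mix star_split starK !mulrDr !mulrA projPP projPQ projQP projQQ.
by rewrite !mul0r addr0 add0r -mulrDl addrC subrK mul1r.
Qed.

Lemma mix1 : mix 1 = 1.
Proof. by rewrite /mix star1 !mulr1 addrC subrK. Qed.

Lemma mix_triple x : mix (x * star x * x) = mix x * star (mix x) * mix x.
Proof. by rewrite /mix star_split !proj_splitM !starM !starK !mulrA. Qed.

Lemma nrm_proj_le : nrm P <= 1.
Proof.
have := nrm_starM P; rewrite star_proj projPP => e.
by have := nrm_ge0 P; nra.
Qed.

Lemma nrm_mix x : nrm (mix x) = nrm x.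
Proof.
have le y : nrm (mix y) <= nrm y.
  (* Crudely, |P| <= 1 and |1 - P| <= 2. *)
  apply: (@triple_contraction _ _ _ mix 3); first exact: mix_triple.
  move=> z; apply: le_trans (nrmD _ _) _.
  have := nrmM P z; have := nrmM (1 - P) (star z); rewrite nrm_star.
  have := nrmB 1 P; have := nrm1_le B; have := nrm_proj_le.
  have := nrm_ge0 z; nra.
by apply/le_anti; rewrite le /= -{1}(mixK x) le.
Qed.

Lemma mix_rl : rl_isometry mix.
Proof.
split; last exact: nrm_mix.
split=> [a b|r a]; first by rewrite /mix starD !mulrDr; ncring.
by rewrite /mix starZr !scAr scalerDr.
Qed.

End Mixing.

(** * Unital surjective real-linear isometries *)

Section LeftMultiplier.
Variables (R : realType) (A B : cstarAlg R) (L : A -> B).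
Hypotheses (HL : rl_isometry L) (L1 : L 1 = 1).
Implicit Types (v b h : B).

(* [K] is a unital isometry within distance 1 of the identity at i, hence
   complex-linear. *)
Lemma ii_transport_unitary (M : B -> A) v : cancel M L -> cancel L M -> rl_isometry M ->
  unitary v -> nrm (v - 1) < 2^-1 ->
  forall b, v * L (ii A * M b) = L (ii A * M (v * b)).
Proof.
move=> ML LM HM uv nv.
have M1 : M 1 = 1 by rewrite -L1 LM.
have sM x : exists y, M y = x by exists (L x).
set g := M v.
have ng : nrm (g - 1) < 2^-1 by rewrite -M1 -(rlB HM) (rlI HM).
have gi : invertibles g.
  have -> : g = 1 - (1 - g) by ncring.
  by apply: neumann; rewrite nrm_distC; lra.
have ug : unitary g by exact: rl_unitary gi.
have ug' := star_unitary ug.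
pose K x := star g * M (v * L x).
have HK : rl_isometry K.
  exact: rl_comp (rl_comp (rl_comp HL (rl_mul uv)) HM) (rl_mul ug').
have sK x : exists y, K y = x.
  exists (M (star v * L (g * x))).
  by rewrite /K ML mulrA uv.2 mul1r LM mulrA ug.1 mul1r.
have K1 : K 1 = 1 by rewrite /K L1 mulr1 ug.1.
have Ki : K (ii A) = ii A.
  apply: near_ii => //.
  rewrite -(nrm_unitaryM _ ug) mulrBr /K mulrA ug.2 mul1r.
  (* Both v and g = M v lie within 1/2 of 1, which leaves a total below the threshold 1 of
     [near_ii]. *)
  have -> : M (v * L (ii A)) - g * ii A = M ((v - 1) * L (ii A)) - (g - 1) * ii A.
    by rewrite mulrBl mul1r (rlB HM) LM; ncring.
  apply: le_lt_trans (nrmB _ _) _; rewrite (rlI HM).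
  have := nrmM (v - 1) (L (ii A)); have := nrmM (g - 1) (ii A).
  rewrite (rlI HL); have := nrm_unitary (unitary_ii A).
  by have := nrm_ge0 (v - 1); have := nrm_ge0 (g - 1); nra.
move=> b; have := unital_ii HK K1 Ki (M b).
rewrite /K ML => /(congr1 (fun z => g * z)).
rewrite (mulrA (ii A) (star g)) -(iiC (star g)) -(mulrA (star g)) !(mulrA g) ug.2 !mul1r => e.
by rewrite -e ML.
Qed.

(** The v satisfying the equation for all b form a real algebra [Z]. It contains the unitaries near
    1, hence by differences all i h with h self-adjoint, and by products with i everything. *)
Lemma ii_transport_left (M : B -> A) : cancel M L -> cancel L M -> rl_isometry M ->
  forall v b, v * L (ii A * M b) = L (ii A * M (v * b)).
Proof.
move=> ML LM HM; pose I b := L (ii A * M b).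
have ID a b : I (a + b) = I a + I b by rewrite /I (rlD HM) mulrDr (rlD HL).
have IZ r b : I (r *r b) = r *r I b by rewrite /I (rlZ HM) scAr (rlZ HL).
pose Z v := forall b, v * I b = I (v * b).
have ZD v w : Z v -> Z w -> Z (v + w) by move=> zv zw b; rewrite !mulrDl ID zv zw.
have ZM v w : Z v -> Z w -> Z (v * w) by move=> zv zw b; rewrite -!mulrA zw zv.
have Zr r v : Z v -> Z (r *r v) by move=> zv b; rewrite !scAl IZ zv.
have Zih h : star h = h -> nrm h <= 1 -> Z (ii B * h).
  (* With |k| <= 1/4 both unitaries c + i k and c - i k are within 1/4 + 1/16 < 1/2 of 1; their
     difference is 2 i k. *)
  move=> hs h1; pose k := 4^-1 *r h.
  have ks : star k = k by rewrite starZr hs.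
  have k1 : nrm k <= 4^-1 by rewrite nrmZr gtr0_norm ?invr_gt0 //; lra.
  have [|c [cs kc c1 cc]] := cos_sin ks; first by lra.
  have ck : k * c = c * k by apply: cc; rewrite mulrA.
  have Zu d : star d = d -> c * d = d * c -> d * d = k * k -> nrm d = nrm k -> Z (c + ii B * d).
    move=> ds cd dd nd b; apply: ii_transport_unitary => //.
      by split; rewrite ?cart_starM ?cart_Mstar // cd subrr mulr0 addr0 dd addrC.
    have -> : c + ii B * d - 1 = ii B * d - (1 - c) by ncring.
    apply: le_lt_trans (nrmB _ _) _; rewrite nrm_ii nd.
    by have := nrmM k k; have := nrm_ge0 k; nra.
  have z1 : Z (c + ii B * k) by apply: Zu.
  have z2 : Z (c + ii B * (- k)).
    by apply: Zu; rewrite ?starN ?ks ?mulrN ?mulNr ?ck ?opprK ?nrmN.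
  have := Zr 2 _ (ZD _ _ z1 (Zr (-1) _ z2)).
  congr Z; rewrite rmorphN scaleN1r /k mulrN opprD opprK addrACA subrr add0r.
  by rewrite scAr -scale2r !scalerA -!rmorphM (_ : _ * _ = 1) ?scale1r //; field.
have Zih' h : star h = h -> Z (ii B * h).
  move=> hs; have n0 : 0 < nrm h + 1 by rewrite ltr_wpDl ?nrm_ge0.
  have -> : ii B * h = (nrm h + 1) *r (ii B * ((nrm h + 1)^-1 *r h)).
    by rewrite scAr scaleKr ?gt_eqF.
  apply/Zr/Zih; first by rewrite starZr hs.
  by rewrite nrmZr gtr0_norm ?invr_gt0 // mulrC ler_pdivrMr // mul1r lerDl.
have Zi : Z (ii B) by rewrite -[ii B]mulr1; apply: Zih'; exact: star1.
have Zh h : star h = h -> Z h.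
  move=> hs; have := Zr (-1) _ (ZM _ _ Zi (Zih' _ hs)).
  by rewrite iiK rmorphN scaleN1r opprK.
by move=> v; rewrite (re_imE v); apply: ZD; [apply/Zh/star_reP|apply/Zih'/star_imP].
Qed.

End LeftMultiplier.

(** * Splitting a unital isometry and Kadison's theorem *)

Section Kadison.
Variables (R : realType) (A B : cstarAlg R) (L : A -> B).
Hypotheses (HL : rl_isometry L) (sL : forall y : B, exists x, L x = y) (L1 : L 1 = 1).
Let s := L (ii A).

Lemma ii_image_central : (forall b, b * s = s * b) /\ forall x, L (ii A * x) = s * L x.
Proof.
have [M HM [ML LM]] := rl_inverse HL sL.
have M1 : M 1 = 1 by rewrite -L1 LM.
have Il b : L (ii A * M b) = b * s.
  have := ii_transport_left HL L1 ML LM HM b 1.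
  by rewrite !mulr1 M1 mulr1.
pose L' x := star (L (star x)); pose M' b := star (M (star b)).
have star_rl (D : cstarAlg R) : rl_isometry (@star R D).
  split; last by move=> x; exact: nrm_star.
  by split=> [a b|r a]; [exact: starD|exact: starZr].
have HL' : rl_isometry L' by exact: rl_comp (rl_comp (star_rl A) HL) (star_rl B).
have HM' : rl_isometry M' by exact: rl_comp (rl_comp (star_rl B) HM) (star_rl A).
have ML' : cancel M' L' by move=> b; rewrite /L' /M' starK ML starK.
have LM' : cancel L' M' by move=> b; rewrite /L' /M' starK LM starK.
have L1' : L' 1 = 1 by rewrite /L' star1 L1 star1.
have Ir b : L (ii A * M b) = s * b.
  have := ii_transport_left HL' L1' ML' LM' HM' (star b) 1.
  rewrite mulr1 /L' /M' !starK star1 M1 star1 mulr1 star_ii (rlN HL).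
  rewrite starM starK star_ii mulrN iiC (rlN HL) -/s -[in LHS]starM.
  by move=> /(can_inj (@starK _ B)); rewrite mulNr => /oppr_inj ->.
split=> [b|x]; first by rewrite -Il Ir.
by rewrite -{1}(LM x) Ir.
Qed.

Lemma star_image_ii : star s = - s.
Proof. by apply: (unital_skew HL L1); exact: star_ii. Qed.

Lemma sq_image_ii : s * s = -1.
Proof. by have := ii_image_central.2 (ii A); rewrite ii_sq (rlN HL) L1. Qed.

Let P : B := 2^-1 *r (1 - ii B * s).

Lemma image_ii_proj : central_projection P.
Proof.
have sC := ii_image_central.1.
pose j := ii B * s.
have js : star j = j by rewrite starM star_image_ii star_ii mulrNN iiC.
have jj : j * j = 1.
  by rewrite /j -mulrA (mulrA s) iiC -(mulrA (ii B)) iiK sq_image_ii opprK.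
split.
- by rewrite starZr starB star1 -/j js.
- rewrite /P -/j scAl scAr; congr (_ *: _).
  have -> : (1 - j) * (1 - j) = (1 - j) + (1 - j).
    have -> : (1 - j) * (1 - j) = 1 - j - j + j * j by ncring.
    by rewrite jj; ncring.
  exact: scale_half.
- move=> b; rewrite /P scAl scAr; congr (_ *: _).
  by rewrite mulrBl mulrBr mul1r mulr1 (mulrA b) iiC -!mulrA sC.
Qed.

Lemma image_ii_projl : s * P = ii B * P.
Proof.
rewrite /P !scAr; congr (_ *: _); rewrite !mulrBr !mulr1 iiK opprK.
by rewrite mulrA iiC -mulrA sq_image_ii mulrN mulr1 opprK addrC.
Qed.

Lemma image_ii_projr : s * (1 - P) = - (ii B * (1 - P)).
Proof.
have e : 1 - P = 2^-1 *r (1 + ii B * s).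
  rewrite -[X in X - _]scale_half -scalerBr; congr (_ *: _); ncring.
rewrite e !scAr -scalerN; congr (_ *: _); rewrite !mulrDr !mulr1 iiK.
by rewrite mulrA iiC -mulrA sq_image_ii mulrN mulr1; ncring.
Qed.

Let J x := mix P (L x).

Lemma kadison_rl : rl_isometry J.
Proof. exact: rl_comp HL (mix_rl image_ii_proj). Qed.

Lemma kadison1 : J 1 = 1.
Proof. by rewrite /J L1 mix1. Qed.

Lemma kadison_surj (y : B) : exists x, J x = y.
Proof.
have [x e] := sL (mix P y); exists x.
by rewrite /J e (mixK image_ii_proj).
Qed.

Lemma kadison_ii : J (ii A) = ii B.
Proof.
have PC := projC image_ii_proj; have QC := projQC image_ii_proj.
rewrite /J /mix -/s star_image_ii mulrN -PC -QC image_ii_projl image_ii_projr.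
by rewrite opprK -mulrDr addrC subrK mulr1.
Qed.

Lemma kadison_linear : linear J.
Proof.
move=> k x y; rewrite (rlD kadison_rl) [k in LHS]complexE [k in RHS]complexE.
rewrite !scalerDl (rlD kadison_rl) (rlZ kadison_rl) mulrC -!scalerA.
rewrite (rlZ kadison_rl).
have -> : 'i%C *: x = ii A * x by rewrite iil.
by rewrite (unital_ii kadison_rl kadison1 kadison_ii) iil.
Qed.

(* Compare the terms of order t^2 in the unitarity of J (c + i t h), where
   c^2 = 1 - t^2 h^2. *)
Lemma kadison_sq_sa h : star h = h -> J (h * h) = J h * J h.
Proof.
move=> hs; have HJ := kadison_rl; have J1 := kadison1; have Ji := kadison_ii.
have Jsa := unital_sa HJ Ji; have Jii := unital_ii HJ J1 Ji.
apply/eqP; rewrite -subr_eq0; apply/eqP; set D := _ - _.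
have n0 := nrm_ge0 h; set n := nrm h in n0.
apply: (@small_eq0 _ _ _ (2 * n ^+ 4)) => e e0.
(* t^2 <= e serves the final estimate; t n <= 1/4 keeps w near 1, so that [J w] is invertible and
   therefore unitary. *)
have [t [t0 te tn]] : exists t : R, [/\ 0 < t, t ^+ 2 <= e & t * n <= 4^-1].
  pose m := Num.min 1 e; pose t := Num.min m (4 * (n + 1))^-1.
  have d0 : 0 < 4 * (n + 1) by lra.
  have m0 : 0 < m by rewrite lt_min ltr01.
  have t0 : 0 < t by rewrite lt_min m0 invr_gt0.
  have tm : t <= m by rewrite ge_min lexx.
  have tn : t <= (4 * (n + 1))^-1 by rewrite ge_min lexx orbT.
  have m1 : m <= 1 by rewrite ge_min lexx.
  have me : m <= e by rewrite ge_min lexx orbT.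
  exists t; split=> //; first by nra.
  have : t * (4 * (n + 1)) <= 1 by rewrite -ler_pdivlMr // mul1r.
  by nra.
pose k := t *r h.
have ks : star k = k by rewrite starZr hs.
have nk : nrm k = t * n by rewrite nrmZr gtr0_norm.
have [|c [cs kc c1 cc]] := cos_sin ks; first by lra.
have ck : k * c = c * k by apply: cc; rewrite mulrA.
pose w := c + ii A * k.
have uw : unitary w.
  by split; rewrite ?cart_starM ?cart_Mstar // ck subrr mulr0 addr0 addrC.
have Jw : unitary (J w).
  apply: rl_unitary => //; first exact: kadison_surj.
  have -> : J w = 1 - J (1 - w) by rewrite (rlB HJ) J1; ncring.
  apply: neumann; rewrite (rlI HJ).
  have -> : 1 - w = (1 - c) - ii A * k by rewrite /w; ncring.
  apply: le_lt_trans (nrmB _ _) _; rewrite nrm_ii.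
  by have := nrmM k k; have := nrm_ge0 k; nra.
have JwE : J w = J c + ii B * J k by rewrite (rlD HJ) Jii.
(* [J c] and [J k] are not known to commute; adding the two unitarity relations of [J w] cancels
   their commutator. *)
have JcJk : J c * J c + J k * J k = 1.
  rewrite -[LHS]scale_half -[RHS]scale_half; congr (_ *: _).
  have := starM_add_Mstar (J w).
  by rewrite JwE reP_cart ?imP_cart ?Jsa // -JwE Jw.1 Jw.2.
(* u is O(t^2), and k^2 = 2 u - u^2 while (J k)^2 = 2 J u - (J u)^2, so the defect t^2 D is
   O(t^4). *)
pose u := 1 - c.
have nu : nrm u <= nrm k ^+ 2 by apply: le_trans c1 _; rewrite expr2 nrmM.
have uE : k * k = u + u - u * u.
  have -> : k * k = (k * k + c * c) - c * c by ncring.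
  by rewrite kc /u; ncring.
have JuE : J k * J k = J u + J u - J u * J u.
  have -> : J k * J k = (J c * J c + J k * J k) - J c * J c by ncring.
  by rewrite JcJk /u (rlB HJ) J1; ncring.
have Dk : t ^+ 2 *r D = J u * J u - J (u * u).
  have -> : t ^+ 2 *r D = J (k * k) - J k * J k.
    by rewrite /k !(rlZ HJ) !scAl !scAr !(rlZ HJ) !scalerA -!rmorphM -expr2 -scalerBr.
  by rewrite JuE {1}uE (rlB HJ) (rlD HJ); ncring.
have nuu : nrm (J u * J u - J (u * u)) <= 2 * (nrm u * nrm u).
  apply: le_trans (nrmB _ _) _; rewrite (rlI HJ).
  by have := nrmM (J u) (J u); have := nrmM u u; rewrite (rlI HJ); lra.
have nD : t ^+ 2 * nrm D <= 2 * (nrm k ^+ 2 * nrm k ^+ 2).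
  have -> : t ^+ 2 * nrm D = nrm (t ^+ 2 *r D) by rewrite nrmZr ger0_norm ?sqr_ge0.
  rewrite Dk; apply: le_trans nuu _; rewrite ler_pM2l //.
  by rewrite ler_pM ?nrm_ge0.
have : nrm D <= 2 * n ^+ 4 * t ^+ 2.
  rewrite -(@ler_pM2l _ (t ^+ 2)) ?exprn_gt0 //; apply: le_trans nD _.
  by rewrite nk le_eqVlt; apply/orP; left; apply/eqP; ring.
move=> /le_trans; apply; apply: ler_wpM2l => //.
by rewrite mulr_ge0 ?exprn_ge0.
Qed.

Lemma kadison_jordan : jordan_star_iso J.
Proof.
have HJ := kadison_rl; have J1 := kadison1; have Ji := kadison_ii.
have Jsq := kadison_sq_sa; have Jii := unital_ii HJ J1 Ji.
split; first exact: kadison_linear.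
- have [M _ [MJ JM]] := rl_inverse HJ kadison_surj.
  by exists M.
- move=> a; have hs := star_reP a; have cs := star_imP a.
  set h := reP a in hs *; set c := imP a in cs *.
  have Jhc : J (h * c + c * h) = J h * J c + J c * J h.
    have -> : h * c + c * h = (h + c) * (h + c) - h * h - c * c by ncring.
    rewrite !(rlB HJ) !Jsq //; last by rewrite starD hs cs.
    by rewrite (rlD HJ); ncring.
  have aE : a = h + ii A * c := re_imE a.
  have -> : J a = J h + ii B * J c by rewrite {1}aE (rlD HJ) Jii.
  have -> : a * a = h * h - c * c + ii A * (h * c + c * h) by rewrite {1 2}aE cartM.
  by rewrite cartM (rlD HJ) (rlB HJ) Jii Jhc !Jsq.
- exact: unital_star.
Qed.

End Kadison.

(** * Local isometries are locally affine *)

Section RealLemmas.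
Variable R : realType.

Lemma pow2_bounded_le0 (c M : R) : (forall n, 2 ^+ n * c <= M) -> c <= 0.
Proof.
move=> H; rewrite leNgt; apply/negP => c0.
have M0 : 0 <= M by have := H 0%N; rewrite expr0 mul1r; lra.
have := archi_boundP (divr_ge0 M0 (ltW c0)); set N := Num.bound _.
rewrite ltr_pdivrMr // => h; have := H N.
have : N%:R * c <= 2 ^+ N * c.
  by rewrite ler_pM2r // -natrX ler_nat ltnW // ltn_expl.
lra.
Qed.

(** Connectedness of [0, 1] for a locally constant predicate. The supremum is reached by one
    direction of the equivalence and passed by the other. *)
Lemma unit_segment_ind (E : R -> Prop) : E 0 ->
  (forall t, 0 <= t <= 1 -> exists2 e, 0 < e &
     forall s, 0 <= s <= 1 -> `|s - t| < e -> (E s <-> E t)) -> E 1.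
Proof.
move=> E0 H; pose S := [set t : R | 0 <= t <= 1 /\ forall s, 0 <= s <= t -> E s].
have S0 : S 0.
  split; first by lra.
  by move=> s s0; have -> : s = 0 by lra.
have hS : has_sup S by split; [exists 0|exists 1 => t [/andP[]]].
pose c := sup S.
have c0 : 0 <= c by apply: sup_upper_bound.
have c1 : c <= 1 by apply: ge_sup; [exists 0|move=> t [/andP[]]].
have [e e0 He] := H c (introT andP (conj c0 c1)).
have [t [t01 St] ct] := sup_adherent e0 hS; rewrite -/c in ct.
have tc : t <= c by apply: sup_upper_bound.
have Ec : E c.
  have /He : 0 <= t <= 1 by [].
  by case=> [|+ _]; [rewrite ltr_norml; lra|apply; apply: St; lra].
have Es s : 0 <= s <= 1 -> s < c + e -> E s.
  move=> s01 sc; have [st|ts] := leP s t; first by apply: St; lra.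
  by apply/(He s) => //; rewrite ltr_norml; lra.
have [d1|d1] := leP 1 (c + e / 2); first by apply: Es; lra.
have : c + e / 2 <= c; last lra.
apply: sup_upper_bound => //; split; first lra.
by move=> s s0; apply: Es; lra.
Qed.

End RealLemmas.

Section AdditiveIsometry.
Variables (R : realType) (A B : cstarAlg R).
Implicit Types (x y a b : A) (r t : R).

(** The homogeneity defect g is additive in t and vanishes at integers, so it is bounded; g(2^n t) =
    2^n g(t) then forces g = 0. *)
Lemma additive_isometry_rl (L : A -> B) : (forall x y, L (x + y) = L x + L y) ->
  (forall x, nrm (L x) = nrm x) -> rl_isometry L.
Proof.
move=> LD LI; split=> //; split=> // r x.
have L0 : L 0 = 0 by apply: nrm_eq0; rewrite LI nrm0.
have LN y : L (- y) = - L y.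
  by apply/eqP; rewrite -addr_eq0 -LD addrC subrr L0.
pose g t := L (t *r x) - t *r L x.
have gD s t : g (s + t) = g s + g t.
  by rewrite /g rmorphD !scalerDl LD; ncring.
have gN t : g (- t) = - g t by rewrite /g rmorphN !scaleNr LN; ncring.
have g1 : g 1 = 0 by rewrite /g !scale1r subrr.
have g0 : g 0 = 0 by rewrite /g !scale0r L0 subrr.
have gn n : g n%:R = 0 by elim: n => // n ih; rewrite -natr1 gD ih g1 addr0.
have gM n t : g (n%:R * t) = n%:R *r g t.
  elim: n => [|n ih]; first by rewrite mul0r g0 scale0r.
  by rewrite -natr1 mulrDl mul1r gD ih rmorphD scalerDl scale1r.
have gb t : 0 <= t -> nrm (g t) <= 2 * nrm x.
  move=> t0; have /andP[tl tu] := truncn_itv t0; set n := Num.truncn t in tl tu.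
  have -> : g t = g (t - n%:R) by rewrite gD gN gn oppr0 addr0.
  apply: le_trans (nrmB _ _) _; rewrite LI !nrmZr LI ger0_norm ?subr_ge0 //.
  by have := nrm_ge0 x; move: tu; rewrite -natr1; nra.
suff gz t : 0 <= t -> g t = 0.
  suff : g r = 0 by move=> /eqP; rewrite subr_eq0 => /eqP.
  have [r0|r0] := leP 0 r; first exact: gz.
  by apply: oppr_inj; rewrite -gN gz ?oppr0 // oppr_ge0 ltW.
move=> t0; apply: nrm_eq0; apply/le_anti; rewrite nrm_ge0 andbT.
apply: (@pow2_bounded_le0 _ _ (2 * nrm x)) => n.
have -> : 2 ^+ n * nrm (g t) = nrm (g ((2 ^ n)%:R * t)).
  by rewrite gM nrmZr natrX ger0_norm ?exprn_ge0.
by apply: gb; rewrite mulr_ge0.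
Qed.

(** The midpoint property gives f(x / 2) = f(x) / 2 near 0, so 2^n f(2^-n x) is independent of n
    once 2^-n x lies in the ball. *)
Lemma extend_local_isometry (f : A -> B) (rho : R) : 0 < rho -> f 0 = 0 ->
  (forall x y, nrm x < rho -> nrm y < rho ->
     f (2^-1 *r (x + y)) = 2^-1 *r (f x + f y)) ->
  (forall x y, nrm x < rho -> nrm y < rho -> nrm (f x - f y) = nrm (x - y)) ->
  exists2 L, rl_isometry L & forall x, nrm x < rho -> f x = L x.
Proof.
move=> rho0 f0 fmid fiso.
pose F n x : B := (2 ^+ n) *r f ((2 ^- n) *r x).
have sm n x : nrm x < rho * 2 ^+ n -> nrm ((2 ^- n) *r x) < rho.
  by move=> h; rewrite nrmZr gtr0_norm ?invr_gt0 ?exprn_gt0 // mulrC ltr_pdivrMr ?exprn_gt0.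
have fhalf x : nrm x < rho -> f (2^-1 *r x) = 2^-1 *r f x.
  by move=> xr; have := fmid x 0 xr; rewrite nrm0 !addr0 f0 addr0; apply.
have FS n x : nrm x < rho * 2 ^+ n -> F n.+1 x = F n x.
  move=> h; rewrite /F [2 ^- n.+1](_ : _ = 2^-1 * 2 ^- n); last by rewrite exprS invfM.
  rewrite rmorphM -scalerA fhalf ?sm // scalerA -rmorphM exprS.
  by rewrite mulrAC mulfV ?pnatr_eq0 // mul1r.
have mono m n x : (n <= m)%N -> nrm x < rho * 2 ^+ n -> nrm x < rho * 2 ^+ m.
  move=> nm /lt_le_trans; apply; rewrite ler_pM2l //.
  by rewrite -!natrX ler_nat leq_pexp2l.
have FE m n x : (n <= m)%N -> nrm x < rho * 2 ^+ n -> F m x = F n x.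
  move=> /subnK <-; elim: (m - n)%N => // k ih h.
  by rewrite addSn FS ?ih //; apply: mono h; rewrite leq_addl.
have /choice[N HN] : forall x : A, exists n, nrm x < rho * 2 ^+ n.
  move=> x; have := archi_boundP (divr_ge0 (nrm_ge0 x) (ltW rho0)).
  set n := Num.bound _; rewrite ltr_pdivrMr // => h; exists n.
  apply: lt_le_trans h _; rewrite mulrC ler_pM2l //.
  by rewrite -natrX ler_nat ltnW // ltn_expl.
pose L x := F (N x) x.
have LE m x : nrm x < rho * 2 ^+ m -> L x = F m x.
  move=> h; have [le|/ltnW le] := leqP m (N x); first exact: FE.
  by symmetry; apply: FE.
exists L; last first.
  move=> x xr; rewrite (LE 0%N) ?expr0 ?mulr1 //.
  by rewrite /F expr0 invr1 !scale1r.
apply: additive_isometry_rl => [x y|x]; last first.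
  rewrite /L /F nrmZr -[f _]subr0 -f0 fiso ?nrm0 ?sm // subr0.
  rewrite nrmZr !gtr0_norm ?invr_gt0 ?exprn_gt0 //.
  by rewrite mulrA mulfV ?mul1r // gt_eqF ?exprn_gt0.
pose m := maxn (N x) (N y).
have hx : nrm x < rho * 2 ^+ m by apply: mono (HN x); exact: leq_maxl.
have hy : nrm y < rho * 2 ^+ m by apply: mono (HN y); exact: leq_maxr.
have hxy : nrm (x + y) < rho * 2 ^+ m.+1.
  by apply: le_lt_trans (nrmD _ _) _; rewrite exprS; lra.
rewrite (LE _ _ hx) (LE _ _ hy) (LE _ _ hxy) /F.
rewrite [2 ^- m.+1](_ : _ = 2^-1 * 2 ^- m); last by rewrite exprS invfM.
rewrite rmorphM -scalerA scalerDr fmid ?sm // scalerA -rmorphM exprS.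
by rewrite mulrAC mulfV ?pnatr_eq0 // mul1r scalerDr.
Qed.

Lemma rl_germ_unique (L M : A -> B) (rho : R) : rl_isometry L -> rl_isometry M ->
  0 < rho -> (forall x, nrm x < rho -> L x = M x) -> L = M.
Proof.
move=> HL HM rho0 H; apply/funext => x.
have n0 : 0 < nrm x + 1 by rewrite ltr_wpDl ?nrm_ge0.
pose t := rho / (nrm x + 1).
have t0 : 0 < t by rewrite divr_gt0.
have : L (t *r x) = M (t *r x).
  apply: H; rewrite nrmZr gtr0_norm // /t mulrAC ltr_pdivrMr //.
  by rewrite ltr_pM2l // ltrDl.
rewrite (rlZ HL) (rlZ HM) => /(congr1 (fun z => t^-1 *r z)).
by rewrite !scalerA -!rmorphM mulVf ?gt_eqF // !scale1r.
Qed.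

End AdditiveIsometry.

(** * Mazur-Ulam near a point and propagation along segments *)

Section LocalIsometry.
Variables (R : realType) (A B : cstarAlg R) (GA : set A) (GB : set B) (T : A -> B).
Hypotheses (oA : open GA) (oB : open GB).
Hypotheses (TG : forall a, GA a -> GB (T a))
  (Ts : forall b, GB b -> exists2 a, GA a & T a = b)
  (TI : forall a b, GA a -> GA b -> nrm (T a - T b) = nrm (a - b)).
Implicit Types (a b x : A) (r t : R).

(* Passing from an isometry g of [H] to f g^-1 f g, with f the reflection in the
   midpoint z, doubles the displacement of z, which is bounded on [H]. *)
Lemma local_mazur_ulam a b : GA a -> GA b ->
  (forall x, nrm (x - a) = nrm (a - b) / 2 -> GA x) ->
  (forall y, nrm (y - T a) = nrm (a - b) / 2 -> GB y) ->
  T (2^-1 *r (a + b)) = 2^-1 *r (T a + T b).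
Proof.
move=> aG bG HA HB; set r := nrm (a - b) / 2 in HA HB; pose z : A := 2^-1 *r (a + b).
(* The metric midpoints of a and b: T maps them onto those of T a and T b, and they lie on the
   spheres assumed to be in the domains. *)
pose H x := nrm (x - a) = r /\ nrm (x - b) = r.
pose H' y := nrm (y - T a) = r /\ nrm (y - T b) = r.
pose f x : A := a + b - x; pose f' y : B := T a + T b - y.
have zz : z + z = a + b by rewrite -scalerDr scale_half.
have zE : f z = z by rewrite /f -zz; ncring.
have fK x : f (f x) = x by rewrite /f; ncring.
have fK' y : f' (f' y) = y by rewrite /f'; ncring.
have fI x y : nrm (f x - f y) = nrm (x - y).
  by rewrite nrm_distC /f; congr nrm; ncring.
have Hf x : H x -> H (f x).
  move=> [h1 h2]; split; rewrite -nrmN.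
    by rewrite (_ : - (f x - a) = x - b) // /f; ncring.
  by rewrite (_ : - (f x - b) = x - a) // /f; ncring.
have Hf' y : H' y -> H' (f' y).
  move=> [h1 h2]; split; rewrite -nrmN.
    by rewrite (_ : - (f' y - T a) = y - T b) // /f'; ncring.
  by rewrite (_ : - (f' y - T b) = y - T a) // /f'; ncring.
have Hz : H z.
  have e x y : 2^-1 *r (x + y) - x = 2^-1 *r (y - x).
    by rewrite -[X in _ - X]scale_half -scalerBr; congr (_ *: _); ncring.
  split; first by rewrite /z e nrmZr gtr0_norm // nrm_distC mulrC.
  by rewrite /z (addrC a b) e nrmZr gtr0_norm // mulrC.
pose iso (g g' : A -> A) := forall x, H x ->
  [/\ H (g x), H (g' x), g (g' x) = x, g' (g x) = x &
     forall y, H y -> nrm (g x - g y) = nrm (x - y) /\ nrm (g' x - g' y) = nrm (x - y)].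
have bound n : forall g g', iso g g' -> 2 ^+ n * nrm (g z - z) <= 2 * r.
  elim: n => [|n ih] g g' gg'.
    rewrite expr0 mul1r; have [[h1 _] _ _ _ _] := gg' _ Hz.
    apply: le_trans (nrm_triangle a _ _) _; rewrite h1 nrm_distC Hz.1; lra.
  pose k x := f (g' (f (g x))); pose k' x := g' (f (g (f x))).
  have kk : iso k k'.
    move=> x Hx; have Hfx := Hf _ Hx.
    have [gx g'x gg'x g'gx _] := gg' _ Hx.
    have Hfgx := Hf _ gx.
    have [_ g'fgx gg'fgx _ gI2] := gg' _ Hfgx.
    have [gfx _ _ g'gfx gI3] := gg' _ Hfx.
    have Hfgfx := Hf _ gfx.
    have [_ g'fgfx gg'fgfx _ gI4] := gg' _ Hfgfx.
    split.
    - exact: Hf.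
    - exact: g'fgfx.
    - by rewrite /k /k' gg'fgfx fK g'gfx fK.
    - by rewrite /k /k' fK gg'fgx fK g'gx.
    move=> y Hy; have Hfy := Hf _ Hy.
    have [gy _ _ _ _] := gg' _ Hy; have [gfy _ _ _ _] := gg' _ Hfy.
    have [_ _ _ _ gI1] := gg' _ Hx.
    split.
      by rewrite /k fI (gI2 _ (Hf _ gy)).2 fI (gI1 _ Hy).1.
    by rewrite /k' (gI4 _ (Hf _ gfy)).2 fI (gI3 _ Hfy).1 fI.
  have := ih _ _ kk.
  have [gz _ _ g'gz _] := gg' _ Hz.
  have [_ _ _ _ gI] := gg' _ (Hf _ gz).
  have -> : nrm (k z - z) = 2 * nrm (g z - z).
    rewrite -{2}zE /k fI -{2}g'gz (gI _ gz).2 /f -zz.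
    rewrite (_ : z + z - g z - g z = - (2 *r (g z - z))).
      by rewrite nrmN nrmZr gtr0_norm.
    by rewrite scale2r; ncring.
  by rewrite exprS; lra.
(* [S] inverts T on [GB]; its values elsewhere are irrelevant. *)
have /choice[S HS] : forall y, exists x, GB y -> GA x /\ T x = y.
  move=> y; have [/Ts[x xG xy]|ny] := pselect (GB y); first by exists x.
  by exists 0.
have HGA x : H x -> GA x by move=> [h _]; exact: HA.
have HGB y : H' y -> GB y by move=> [h _]; exact: HB.
have HT x : H x -> H' (T x).
  by move=> Hx; have [h1 h2] := Hx; split; rewrite TI //; exact: HGA.
have ST x : GA x -> S (T x) = x.
  move=> xG; have [SG e] := HS _ (TG xG).
  by apply/eqP; rewrite -subr_eq0; apply/eqP/nrm_eq0; rewrite -TI // e subrr nrm0.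
have SI y y' : GB y -> GB y' -> nrm (S y - S y') = nrm (y - y').
  by move=> /HS[g1 e1] /HS[g2 e2]; rewrite -TI // e1 e2.
have HSH y : H' y -> H (S y).
  move=> Hy; have [h1 h2] := Hy; have yG := HGB _ Hy.
  by split; [rewrite -h1 -{1}(ST _ aG)|rewrite -h2 -{1}(ST _ bG)]; rewrite SI //; exact: TG.
have TS y : H' y -> T (S y) = y by move=> /HGB/HS[].
(* If g fixes z, then T z is fixed by the reflection f', so it is the midpoint of T a and T b. *)
pose g x := f (S (f' (T x))); pose g' x := S (f' (T (f x))).
have gg : iso g g'.
  move=> x Hx; have H1 := HT _ Hx; have H2 := Hf' _ H1; have H3 := HSH _ H2.
  have K0 := Hf _ Hx; have K1 := HT _ K0; have K2 := Hf' _ K1; have K3 := HSH _ K2.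
  split.
  - exact: Hf.
  - exact: K3.
  - by rewrite /g /g' TS // fK' ST ?fK //; exact: HGA.
  - by rewrite /g /g' fK TS // fK' ST //; exact: HGA.
  have f'I y1 y2 : nrm (f' y1 - f' y2) = nrm (y1 - y2).
    by rewrite nrm_distC /f'; congr nrm; ncring.
  move=> y Hy; have L1 := Hf' _ (HT _ Hy); have L2 := Hf' _ (HT _ (Hf _ Hy)).
  split.
    by rewrite /g fI SI ?f'I ?TI //; first [exact: HGA|exact: HGB].
  rewrite /g' SI ?f'I ?TI ?fI //; first [exact: HGA|exact: HGB|exact/HGA/Hf].
have gz0 : g z = z.
  apply/eqP; rewrite -subr_eq0; apply/eqP/nrm_eq0/le_anti.
  by rewrite nrm_ge0 andbT; apply: (@pow2_bounded_le0 _ _ (2 * r)) => n; exact: bound gg.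
have : f' (T z) = T z.
  rewrite -[LHS]TS; last exact/Hf'/HT.
  by congr T; rewrite -[LHS]fK -/(g z) gz0 zE.
by rewrite -/z => e; rewrite -[LHS]scale_half -{1}e /f' subrK.
Qed.

Definition germ a (L : A -> B) :=
  exists2 rho : R, 0 < rho & forall x, nrm x < rho -> T (a + x) = T a + L x.

Lemma germ_exists a : GA a -> exists2 L, rl_isometry L & germ a L.
Proof.
move=> aG; have [e1 e10 H1] := open_ball oA aG; have [e2 e20 H2] := open_ball oB (TG aG).
(* Half the radius: spheres of radius below rho around points within rho of the centre stay in the
   ball. *)
pose rho := Num.min e1 e2 / 2.
have m0 : 0 < Num.min e1 e2 by rewrite lt_min e10.
have m1 : Num.min e1 e2 <= e1 by rewrite ge_min lexx.
have m2 : Num.min e1 e2 <= e2 by rewrite ge_min lexx orbT.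
have rho0 : 0 < rho by rewrite divr_gt0.
have r1 : 2 * rho <= e1 by rewrite mulrC divfK ?pnatr_eq0.
have r2 : 2 * rho <= e2 by rewrite mulrC divfK ?pnatr_eq0.
have inA x : nrm x < rho -> GA (a + x).
  by move=> xr; apply: H1; rewrite (addrC a) addrK; lra.
have [|x y xr yr|x y xr yr|L HL LE] :=
    @extend_local_isometry _ A B (fun x => T (a + x) - T a) rho rho0.
- by rewrite addr0 subrr.
- have nxy : nrm (a + x - (a + y)) < 2 * rho.
    rewrite (_ : a + x - (a + y) = x - y); last ncring.
    by apply: le_lt_trans (nrmB _ _) _; lra.
  have nx : nrm (a + x - a) = nrm x by rewrite (addrC a) addrK.
  have := @local_mazur_ulam (a + x) (a + y) (inA _ xr) (inA _ yr).
  have -> : 2^-1 *r (a + x + (a + y)) = a + 2^-1 *r (x + y).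
    have -> : a + x + (a + y) = (a + a) + (x + y) by ncring.
    by rewrite scalerDr scale_half.
  move=> -> => [|w wr|w wr].
  + rewrite (_ : T (a + x) - T a + (T (a + y) - T a)
      = (T (a + x) + T (a + y)) - (T a + T a)); last ncring.
    by rewrite scalerBr scale_half.
  + apply: H1; apply: le_lt_trans (nrm_triangle (a + x) _ _) _.
    by rewrite wr nx; lra.
  + apply: H2; apply: le_lt_trans (nrm_triangle (T (a + x)) _ _) _.
    rewrite wr TI //; last exact: inA.
    by rewrite nx; lra.
- rewrite (_ : _ - _ - _ = T (a + x) - T (a + y)); last ncring.
  by rewrite TI; [congr nrm; ncring|exact: inA|exact: inA].
by exists L => //; exists rho => // x xr; rewrite -LE // [RHS]addrC subrK.
Qed.

(** Agreement of T with the affine map T a + L(x - a) near the point of parameter t is locally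
    constant in t: germs at nearby points overlap, and [rl_germ_unique] identifies their linear
    parts. *)
Lemma germ_segment a b L : rl_isometry L -> germ a L ->
  (forall t : R, 0 <= t <= 1 -> GA (a + t *r (b - a))) ->
  germ b L /\ T b = T a + L (b - a).
Proof.
move=> HL gL seg; pose p t : A := a + t *r (b - a).
pose E t := exists2 rho, 0 < rho &
  forall x, nrm x < rho -> T (p t + x) = T a + L (p t - a + x).
have p0 : p 0 = a by rewrite /p scale0r addr0.
have p1 : p 1 = b by rewrite /p scale1r addrC subrK.
suff [rho rho0 H] : E 1.
  have Tb : T b = T a + L (b - a).
    by have := H 0; rewrite nrm0 p1 !addr0; apply.
  split=> //; exists rho => // x xr; have := H x xr.
  by rewrite p1 (rlD HL) addrA -Tb.
apply: unit_segment_ind.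
  have [rho rho0 H] := gL; exists rho => // x xr.
  by rewrite p0 subrr add0r H.
move=> t t01; have [M HM [rho rho0 Mr]] := germ_exists (seg _ t01); rewrite -/(p t) in Mr.
have n0 : 0 < nrm (b - a) + 1 by rewrite ltr_wpDl ?nrm_ge0.
exists (rho / 2 / (nrm (b - a) + 1)); first by rewrite !divr_gt0.
move=> s s01 st; pose d := p s - p t.
have nd : nrm d < rho / 2.
  have -> : d = (s - t) *r (b - a) by rewrite /d /p rmorphB scalerBl; ncring.
  rewrite nrmZr; move: st; rewrite ltr_pdivlMr //.
  by have := normr_ge0 (s - t); have := nrm_ge0 (b - a); nra.
have psE : p s = p t + d by rewrite /d addrC subrK.
have loc x : nrm x < rho / 2 -> T (p s + x) = T (p t) + M (d + x).
  move=> xr; rewrite psE -addrA Mr //.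
  by apply: le_lt_trans (nrmD _ _) _; lra.
split=> [[e e0 Ee]|[e e0 Ee]].
- pose m := Num.min e (rho / 2).
  have m0 : 0 < m by rewrite lt_min e0 divr_gt0.
  have both x : nrm x < m -> T (p t) + M (d + x) = T a + L (p s - a + x).
    by rewrite lt_min => /andP[xe xr]; rewrite -loc // Ee.
  have h0 := both 0; rewrite nrm0 !addr0 in h0; have {}h0 := h0 m0.
  have LM : M = L.
    apply: (rl_germ_unique HM HL m0) => x xm; have := both x xm.
    by rewrite (rlD HM) (rlD HL) !addrA h0 => /addrI.
  have Tpt : T (p t) = T a + L (p t - a).
    apply: (addIr (M d)); rewrite h0 -[RHS]addrA LM -(rlD HL); congr (_ + L _).
    by rewrite psE; ncring.
  exists rho => // x xr; rewrite Mr // Tpt LM (rlD HL _ x); ncring.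
- pose m := Num.min e rho.
  have m0 : 0 < m by rewrite lt_min e0.
  have both x : nrm x < m -> T (p t) + M x = T a + L (p t - a + x).
    by rewrite lt_min => /andP[xe xr]; rewrite -Mr // Ee.
  have h0 := both 0; rewrite nrm0 !addr0 (rl0 HM) addr0 in h0; have {}h0 := h0 m0.
  have LM : M = L.
    apply: (rl_germ_unique HM HL m0) => x xm; have := both x xm.
    by rewrite (rlD HL) !addrA h0 => /addrI.
  exists (rho / 2); first by rewrite divr_gt0.
  move=> x xr; rewrite loc // h0 LM psE -[LHS]addrA -(rlD HL); congr (_ + L _); ncring.
Qed.

End LocalIsometry.

(** * Isometries between open subgroups *)

Section OpenSubgroup.
Variables (R : realType) (A : cstarAlg R) (G : set A).
Hypothesis HG : open_subgroup G.
Implicit Types (k l : R[i]) (r s : R) (x : A).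

Lemma osg1 : G 1. Proof. by case: HG. Qed.
Lemma osgM x y : G x -> G y -> G (x * y). Proof. by case: HG => _ _ + _ _; apply. Qed.
Lemma osg_open : open G. Proof. by case: HG. Qed.
Lemma osg_inv x : G x -> invertibles x. Proof. by case: HG => + _ _ _ _; apply. Qed.
Lemma osgV x : G x -> exists2 y, G y & inverses x y.
Proof.
move=> xG; have [y xy] := osg_inv xG; exists y => //.
by case: HG => _ _ _ + _; apply; [exact: xG|exact: xy].
Qed.

(** The ratio of two nearby scalars on the segment is close to 1, hence in G, so membership in G is
    locally constant. *)
Lemma osg_scalar_segment k l : (forall t : R, 0 <= t <= 1 -> k + t%:C%C * (l - k) != 0) ->
  G (k *: (1 : A)) -> G (l *: (1 : A)).
Proof.
move=> nz Gk; pose p (t : R) := k + t%:C%C * (l - k).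
have [e e0 He] := open_ball osg_open osg1.
suff : G (p 1 *: (1 : A)) by rewrite /p rmorph1 mul1r addrC subrK.
apply: (@unit_segment_ind _ (fun t => G (p t *: (1 : A)))).
  by rewrite /p rmorph0 mul0r addr0.
move=> t t01; have pt0 := nz _ t01; rewrite -/(p t) in pt0.
pose D := complex.Re `|(l - k) / p t|.
have D0 : 0 <= D by rewrite -ler0c RRe_real ?normr_real.
have D1 : 0 < D + 1 by rewrite ltr_wpDl.
exists (e / (D + 1)); first by rewrite divr_gt0.
move=> s s01 st1.
pose q := p s / p t.
have qE : q - 1 = (s - t)%:C%C * ((l - k) / p t).
  rewrite /q -[X in _ - X](mulfV pt0) -mulrBl mulrA; congr (_ * _).
  by rewrite /p rmorphB /=; ring.
have nq : nrm (q *: (1 : A) - 1) <= `|s - t| * D.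
  rewrite -[X in _ - X]scale1r -scalerBl qE -scalerA nrmZr ler_wpM2l //.
  rewrite nrmZ -/D; have := nrm1_le A; nra.
have Gq : G (q *: (1 : A)).
  apply: He; apply: le_lt_trans nq _.
  rewrite ltr_pdivlMr // in st1; apply: le_lt_trans st1.
  by rewrite ler_wpM2l // lerDl.
have [y Gy [qy yq]] := osgV Gq.
have pqs : p s *: (1 : A) = (q *: (1 : A)) * (p t *: (1 : A)).
  by rewrite scAl mul1r scalerA /q divfK.
split=> H; last by rewrite pqs; exact: osgM.
have -> : p t *: (1 : A) = y * (p s *: (1 : A)) by rewrite pqs mulrA yq mul1r.
exact: osgM.
Qed.

Lemma osg_rc r : 0 < r -> G (rc A r).
Proof.
move=> r0; apply: (@osg_scalar_segment 1); last by rewrite scale1r; exact: osg1.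
move=> t t01; rewrite -[1](rmorph1 (real_complex R)) -rmorphB -rmorphM -rmorphD.
apply: real_complex_neq0; apply: lt0r_neq0; nra.
Qed.

Lemma osg_rcM r x : 0 < r -> G x -> G (r *r x).
Proof. by move=> r0 Gx; rewrite -rcl; apply: osgM => //; exact: osg_rc. Qed.

(** The chord from 1 to i avoids 0; germs propagate along straight segments, so the chord itself is
    needed. *)
Lemma osg_arc t : 0 <= t <= 1 -> G (1 + t *r (ii A - 1)).
Proof.
move=> t01.
have -> : 1 + t *r (ii A - 1) = (1 + t%:C%C * ('i - 1)) *: (1 : A).
  by rewrite scalerDl scale1r -scalerA scalerBl scale1r.
apply: (@osg_scalar_segment 1); last by rewrite scale1r; exact: osg1.
move=> s s01; apply/eqP => e.
by move: (congr1 (@complex.Re R) e) (congr1 (@complex.Im R) e) => /=; nra.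
Qed.

Lemma osg_ii : G (ii A).
Proof. by have := @osg_arc 1; rewrite scale1r addrC subrK; apply; lra. Qed.

(* The elements whose translations preserve [G] form a left ideal, so it contains
   [star n * n], which then has no nonzero real number in its spectrum. *)
Lemma translation_eq0 n : (forall g, G g -> G (g + n)) -> (forall g, G g -> G (g - n)) ->
  n = 0.
Proof.
pose N m := forall g, G g -> G (g + m).
move=> Np Nm; change (N n) in Np; change (N (- n)) in Nm.
have ND m m' : N m -> N m' -> N (m + m').
  by move=> h h' g Gg; rewrite addrA; apply/h'/h.
have NM m x : G x -> N m -> N (x * m).
  move=> Gx h g Gg; have [y Gy [xy yx]] := osgV Gx.
  have -> : g + x * m = x * (y * g + m) by rewrite mulrDr mulrA xy mul1r.
  by apply: osgM => //; apply: h; apply: osgM.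
have [e e0 He] := open_ball osg_open osg1.
have Nx m x : N m -> N (- m) -> N (x * m).
  move=> h h'; have n0 : 0 < nrm x + 1 by rewrite ltr_wpDl ?nrm_ge0.
  pose t := e / (nrm x + 1); have t0 : 0 < t by rewrite divr_gt0.
  have Gt : G (1 + t *r x).
    apply: He; rewrite (addrC 1) addrK nrmZr gtr0_norm // /t mulrAC ltr_pdivrMr //.
    by rewrite ltr_pM2l // ltrDl.
  have : N (t *r (x * m)).
    have -> : t *r (x * m) = (1 + t *r x) * m - m.
      by rewrite mulrDl mul1r scAl; ncring.
    by apply: ND => //; exact: NM.
  move=> /(NM _ (rc A t^-1)); rewrite rcl scalerA -rmorphM mulVf ?gt_eqF // scale1r.
  by apply; apply: osg_rc; rewrite invr_gt0.
pose h := star n * n.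
have hs : star h = h by rewrite starM starK.
suff h0 : h = 0.
  apply: nrm_eq0; have := nrm_starM n; rewrite -/h h0 nrm0.
  by move=> /esym/eqP; rewrite sqrf_eq0 => /eqP.
apply: contrapT => h0; have n0 := nrm_gt0 h0.
have Nh : N h by exact: Nx.
have Nh' : N (- h) by rewrite /h -mulNr; exact: Nx.
by apply: (spectrum_sa hs h0); apply: osg_inv; [apply: Nh'|apply: Nh]; exact: osg_rc.
Qed.

End OpenSubgroup.

(** Passing to real parts does not increase norms, and [shift_sa] then excludes a nonzero real part
    of d. *)
Lemma shift_reP0 (R : realType) (A : cstarAlg R) (d : A) (s : R) : 0 <= s ->
  nrm (rc A s + d) <= s -> nrm (rc A s - d) <= s -> star d = - d.
Proof.
move=> s0 d1 d2; set h := reP d; have hs : star h = h := star_reP d.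
suff h0 : h = 0.
  apply/eqP; rewrite -addr_eq0 addrC -(scale_half (d + star d)) scalerDr.
  by rewrite -/(reP d) -/h h0 addr0.
apply: contrapT => h0; have n0 := nrm_gt0 h0.
have reE x : nrm (rc A s + reP x) <= nrm (rc A s + x).
  rewrite {2}(re_imE x) addrA.
  have e : star (rc A s + reP x) = rc A s + reP x by rewrite starD star_rc star_reP.
  have := nrm_reP ((rc A s + reP x) + ii A * imP x).
  by rewrite reP_cart // star_imP.
have reN : reP (- d) = - h by rewrite /h /reP starN -opprD scalerN.
have := shift_sa s hs h0; have := reE d; have := reE (- d); rewrite reN -/h.
by move=> e1 e2 [] ?; lra.
Qed.

(** * Extension to a real-linear isometry *)

Section Extension.
Variables (R : realType) (A B : cstarAlg R) (GA : set A) (GB : set B) (T : A -> B).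
Hypotheses (HA : open_subgroup GA) (HB : open_subgroup GB).
Hypotheses (TG : forall a, GA a -> GB (T a))
  (Ts : forall b, GB b -> exists2 a, GA a & T a = b)
  (TI : forall a b, GA a -> GA b -> nrm (T a - T b) = nrm (a - b)).

Let oA := osg_open HA.
Let oB := osg_open HB.

Lemma ray_segment a r : GA a -> 0 < r ->
  forall t : R, 0 <= t <= 1 -> GA (a + t *r (r *r a - a)).
Proof.
move=> aG r0 t t01.
have -> : a + t *r (r *r a - a) = (1 + t * (r - 1)) *r a.
  rewrite rmorphD rmorphM rmorphB scalerDl scale1r -scalerA; congr (_ + _ *: _).
  by rewrite scalerBl scale1r.
by apply: (osg_rcM HA) => //; nra.
Qed.

(* Along rays T is affine with the same limit c at 0, so GB is a cone with vertex
   c as well as with vertex 0, and c = 0 by [translation_eq0]. *)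
Lemma isometry_homogeneous a L : GA a -> rl_isometry L -> germ T a L -> T a = L a.
Proof.
move=> aG HL gL.
have [L1 HL1 gL1] := germ_exists oA oB TG Ts TI (osg1 HA).
have ray x M r : GA x -> rl_isometry M -> germ T x M -> 0 < r ->
    T (r *r x) = (T x - M x) + r *r M x.
  move=> xG HM gM r0.
  have [_ ->] := germ_segment oA oB TG Ts TI HM gM (ray_segment xG r0).
  by rewrite (rlB HM) (rlZ HM); ncring.
pose c := T 1 - L1 1.
have cE x M : GA x -> rl_isometry M -> germ T x M -> T x - M x = c.
  move=> xG HM gM; apply/eqP; rewrite -subr_eq0; apply/eqP.
  (* T(e x) and T(e 1) are at distance e |x - 1|; as e tends to 0 the two constant terms
     coincide. *)
  apply: (@small_eq0 _ _ _ (nrm (x - 1) + nrm (M x - L1 1))) => e e0.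
  have Gx := osg_rcM HA e0 xG; have G1 := osg_rcM HA e0 (osg1 HA).
  have := TI Gx G1; rewrite (ray _ _ _ xG HM gM e0) (ray _ _ _ (osg1 HA) HL1 gL1 e0).
  rewrite -/c -scalerBr nrmZr gtr0_norm // => eq.
  have -> : T x - M x - c = (T x - M x + e *r M x - (c + e *r L1 1)) - e *r (M x - L1 1).
    by rewrite scalerBr; ncring.
  apply: le_trans (nrmB _ _) _; rewrite eq nrmZr gtr0_norm //; lra.
have cone x r : GA x -> 0 < r -> GB (c + r *r (T x - c)).
  move=> xG r0; have [M HM gM] := germ_exists oA oB TG Ts TI xG.
  have e := cE _ _ xG HM gM.
  have -> : c + r *r (T x - c) = T (r *r x).
    rewrite (ray _ _ _ xG HM gM r0) e; congr (_ + _ *: _).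
    by rewrite -e; ncring.
  by apply: TG; exact: osg_rcM.
have coneB b r : GB b -> 0 < r -> GB (c + r *r (b - c)).
  by move=> /Ts[x xG <-]; exact: cone.
(* Combining the dilations about c and about 0 gives translations: 2 (c + (b - c) / 2) = b + c and c
   + 2 (b / 2 - c) = b - c. *)
have c0 : c = 0.
  apply: (translation_eq0 HB) => b bG.
    have half0 : 0 < 2^-1 :> R by rewrite invr_gt0.
    have := osg_rcM HB (ltr0n R 2) (coneB _ _ bG half0); congr GB.
    rewrite scalerDr scaleKr ?pnatr_eq0 // scale2r; ncring.
  have half0 : 0 < 2^-1 :> R by rewrite invr_gt0.
  have := coneB _ _ (osg_rcM HB half0 bG) (ltr0n R 2); congr GB.
  by rewrite scalerBr scaleKr ?pnatr_eq0 // scale2r; ncring.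
by have := cE _ _ aG HL gL; rewrite c0 => /eqP; rewrite subr_eq0 => /eqP.
Qed.

(* If T a = L m, then d = m - a satisfies `|s k - d| = s for k in {1, -1, i, -i}
   and large s, which forces d = 0. *)
Lemma isometry_extension : exists L : A -> B, [/\ rl_isometry L,
  (forall y, exists x, L x = y) & forall a, GA a -> T a = L a].
Proof.
have [L HL gL] := germ_exists oA oB TG Ts TI (osg1 HA).
have sL y : exists x, L x = y.
  have [rho rho0 Lr] := gL; have [e e0 He] := open_ball oB (TG (osg1 HA)).
  have n0 : 0 < nrm y + 1 by rewrite ltr_wpDl ?nrm_ge0.
  have m0 : 0 < Num.min rho e by rewrite lt_min rho0.
  pose t := Num.min rho e / (nrm y + 1); have t0 : 0 < t by rewrite divr_gt0.
  have nt : nrm (t *r y) < Num.min rho e.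
    by rewrite nrmZr gtr0_norm // /t mulrAC ltr_pdivrMr // ltr_pM2l // ltrDl.
  move: nt; rewrite lt_min => /andP[tr te].
  have [|a aG Ta] := Ts (b := T 1 + t *r y).
    by apply: He; rewrite (addrC (T 1)) addrK.
  have ar : nrm (a - 1) < rho.
    by rewrite -TI // ?Ta; [rewrite (addrC (T 1)) addrK|exact: osg1].
  exists (t^-1 *r (a - 1)); rewrite (rlZ HL).
  have := Lr _ ar; rewrite (addrC 1) subrK Ta => /addrI <-.
  by rewrite scalerA -rmorphM mulVf ?gt_eqF // scale1r.
exists L; split=> // a aG.
have [m mE] := sL (T a); rewrite -mE; congr L.
apply/eqP; rewrite -subr_eq0; apply/eqP; set d := m - a.
(* T(s k + a) = L(s k + a) and T a = L m, so |s k - d| is the distance of the images, which equals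
   that of s k + a and a. *)
have key k : GA k -> germ T k L -> exists2 s0 : R, 0 < s0 &
    forall s, s0 <= s -> nrm (s *r k - d) = nrm (s *r k).
  move=> kG gk; have [rho rho0 Lr] := gk; have [e e0 He] := open_ball oA kG.
  have n0 : 0 < nrm a + 1 by rewrite ltr_wpDl ?nrm_ge0.
  have m0 : 0 < Num.min rho e by rewrite lt_min rho0.
  exists ((nrm a + 1) / Num.min rho e); first by rewrite divr_gt0.
  move=> s; rewrite ler_pdivrMr // => hs.
  have s0 : 0 < s by nra.
  pose y := s^-1 *r a.
  have ny : nrm y < Num.min rho e.
    by rewrite nrmZr gtr0_norm ?invr_gt0 // mulrC ltr_pdivrMr //; nra.
  move: ny; rewrite lt_min => /andP[yr ye].
  have kyG : GA (k + y) by apply: He; rewrite (addrC k) addrK.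
  have Tk : T k = L k by exact: isometry_homogeneous.
  have gky : germ T (k + y) L.
    have d0 : 0 < rho - nrm y by rewrite subr_gt0.
    exists (rho - nrm y) => // x xr.
    have yxr : nrm (y + x) < rho by apply: le_lt_trans (nrmD _ _) _; lra.
    by rewrite -[k + y + x]addrA (Lr _ yxr) (Lr _ yr) (rlD HL); ncring.
  have skyG := osg_rcM HA s0 kyG.
  have Tsky : T (s *r (k + y)) = s *r L (k + y).
    have [_ ->] := germ_segment oA oB TG Ts TI HL gky (ray_segment kyG s0).
    by rewrite (isometry_homogeneous kyG HL gky) (rlB HL) (rlZ HL); ncring.
  have := TI skyG aG; rewrite Tsky -mE -(rlZ HL) -(rlB HL) (rlI HL).
  have -> : s *r (k + y) = s *r k + a by rewrite scalerDr /y scaleKr ?gt_eqF.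
  by rewrite addrK => <-; congr nrm; rewrite /d; ncring.
have gi k : GA k -> germ T k L -> germ T (ii A * k) L.
  move=> kG gk; have [] // := germ_segment (b := ii A * k) oA oB TG Ts TI HL gk.
  move=> t t01; have := osgM HA (osg_arc HA t01) kG; congr GA.
  by rewrite mulrDl mul1r scAl mulrBl mul1r.
have G1 := osg1 HA; have Gi := osg_ii HA.
have G2 := osgM HA Gi G1; have G3 := osgM HA Gi G2; have G4 := osgM HA Gi G3.
have g2 := gi _ G1 gL; have g3 := gi _ G2 g2; have g4 := gi _ G3 g3.
have [s1 s10 k1] := key _ G1 gL; have [s2 _ k2] := key _ G2 g2.
have [s3 _ k3] := key _ G3 g3; have [s4 _ k4] := key _ G4 g4.
pose s := Num.max (Num.max s1 s2) (Num.max s3 s4).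
have [m1 m2 m3 m4] : [/\ s1 <= s, s2 <= s, s3 <= s & s4 <= s].
  by rewrite /s !le_max !lexx ?orbT.
have s0 : 0 <= s by lra.
have n1 x : nrm (s *r x) = nrm (s *r (ii A * x)) by rewrite !nrmZr nrm_ii.
have ns : nrm (rc A s) <= s by have := nrm_rc A s; rewrite ger0_norm.
move: (k1 _ m1) (k2 _ m2) (k3 _ m3) (k4 _ m4) => {k1 k2 k3 k4} k1 k2 k3 k4.
rewrite mulr1 in k2; rewrite mulr1 ii_sq scalerN !nrmN in k3.
rewrite mulr1 iiK scalerN !nrmN in k4.
(* The points s and - s make d skew, the points i s and - i s make i d skew; together d = 0. *)
have ds : star d = - d.
  apply: (shift_reP0 s0); last by rewrite k1.
  by rewrite -nrmN opprD k3.
have ids : star (ii A * d) = - (ii A * d).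
  apply: (shift_reP0 s0); rewrite -nrm_ii.
    by rewrite mulrDr rcr iiK k2 -[ii A]mulr1 -n1.
  by rewrite mulrBr rcr iiK opprK -nrmN opprD k4 -[ii A]mulr1 -n1.
have dd : d = - d.
  move: ids; rewrite starM star_ii mulrN iiC ds mulrN => /(congr1 (fun z => ii A * z)).
  by rewrite !mulrN !iiK !opprK.
by rewrite -[d]scale_half {2}dd subrr scaler0.
Qed.

End Extension.

(** * Jordan *-isomorphisms are isometric *)

Section JordanIsometry.
Variables (R : realType) (A B : cstarAlg R) (J : A -> B).
Hypothesis HJ : jordan_star_iso J.
Implicit Types (x y h : A).

Lemma jordanD x y : J (x + y) = J x + J y.
Proof. by case: HJ => lJ _ _ _; have := lJ 1 x y; rewrite !scale1r. Qed.

Lemma jordan0 : J 0 = 0.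
Proof. by apply: (addrI (J 0)); rewrite -jordanD !addr0. Qed.

Lemma jordanZ k x : J (k *: x) = k *: J x.
Proof. by case: HJ => lJ _ _ _; have := lJ k x 0; rewrite jordan0 !addr0. Qed.

Lemma jordanN x : J (- x) = - J x.
Proof. by rewrite -scaleN1r jordanZ scaleN1r. Qed.

Lemma jordan_sq x : J (x * x) = J x * J x. Proof. by case: HJ. Qed.
Lemma jordan_star x : J (star x) = star (J x). Proof. by case: HJ. Qed.

Lemma jordan_anticomm x y : J (x * y + y * x) = J x * J y + J y * J x.
Proof.
have -> : x * y + y * x = (x + y) * (x + y) - x * x - y * y by ncring.
by rewrite !jordanD !jordanN !jordan_sq jordanD; ncring.
Qed.

Lemma jordan_sandwich x y : J (x * y * x) = J x * J y * J x.
Proof.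
rewrite -[LHS]scale_half -[RHS]scale_half; congr (_ *: _); rewrite -jordanD.
have -> : x * y * x + x * y * x = (x * y + y * x) * x + x * (x * y + y * x)
  - ((x * x) * y + y * (x * x)) by ncring.
by rewrite jordanD jordanN !jordan_anticomm jordan_sq; ncring.
Qed.

Lemma jordan_triple x : J (x * star x * x) = J x * star (J x) * J x.
Proof. by rewrite jordan_sandwich jordan_star. Qed.

(** As w w^* w = w, the image satisfies |J w|^3 <= |J w|. *)
Lemma nrm_jordan_unitary (w : A) : unitary w -> nrm (J w) <= 1.
Proof.
move=> uw; have := nrm_triple_ge (J w); rewrite -jordan_triple uw.2 mul1r.
move=> le; rewrite leNgt; apply/negP => lt1; move: le; rewrite leNgt => /negP; apply.
by rewrite !exprS expr0 mulr1; nra.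
Qed.

(** A self-adjoint contraction is the mean of the unitaries g + i c and g - i c. *)
Lemma nrm_jordan_sa h : star h = h -> nrm (J h) <= nrm h.
Proof.
have unit_ball g : star g = g -> nrm g <= 1 -> nrm (J g) <= 1.
  move=> gs g1; have [c [cs gc _ cc]] := cos_sin gs g1.
  have cg : g * c = c * g by apply: cc; rewrite mulrA.
  have uw : unitary (g + ii A * c).
    by split; rewrite ?cart_starM ?cart_Mstar // cg subrr mulr0 addr0.
  have <- := reP_cart gs cs; rewrite jordanZ nrmZr gtr0_norm ?invr_gt0 // jordanD.
  have := nrmD (J (g + ii A * c)) (J (star (g + ii A * c))).
  have := nrm_jordan_unitary uw; have := nrm_jordan_unitary (star_unitary uw); lra.
move=> hs; have [->|/nrm_gt0 h0] := pselect (h = 0); first by rewrite jordan0 !nrm0.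
have := unit_ball ((nrm h)^-1 *r h); rewrite starZr hs nrmZr gtr0_norm ?invr_gt0 //.
rewrite mulVf ?gt_eqF // => /(_ erefl (lexx _)).
by rewrite jordanZ nrmZr gtr0_norm ?invr_gt0 // mulrC ler_pdivrMr // mul1r.
Qed.

Lemma nrm_jordan_le x : nrm (J x) <= nrm x.
Proof.
apply: (@triple_contraction _ _ _ J 2); first exact: jordan_triple.
move=> y; rewrite {1}(re_imE y) jordanD iil (jordanZ 'i).
apply: le_trans (nrmD _ _) _; rewrite nrmZi.
have := nrm_jordan_sa (star_reP y); have := nrm_jordan_sa (star_imP y).
by have := nrm_reP y; have := nrm_imP y; lra.
Qed.

End JordanIsometry.

Lemma jordan_inverse (R : realType) (A B : cstarAlg R) (J : A -> B) :
  jordan_star_iso J -> exists2 K, jordan_star_iso K & cancel J K /\ cancel K J.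
Proof.
move=> HJ; case: (HJ) => _ [K JK KJ] _ _; exists K => //.
have J_inj := can_inj JK.
split.
- by move=> k x y; apply: J_inj; rewrite (jordanD HJ) (jordanZ HJ) !KJ.
- by exists J.
- by move=> x; apply: J_inj; rewrite (jordan_sq HJ) !KJ.
- by move=> x; apply: J_inj; rewrite (jordan_star HJ) !KJ.
Qed.

Lemma jordan_rl (R : realType) (A B : cstarAlg R) (J : A -> B) :
  jordan_star_iso J -> rl_isometry J.
Proof.
move=> HJ; have [K HK [JK _]] := jordan_inverse HJ.
split; first by split=> [x y|r x]; rewrite ?(jordanD HJ) // (jordanZ HJ).
move=> x; apply/le_anti; rewrite (nrm_jordan_le HJ) /=.
by rewrite -{1}(JK x); exact: nrm_jordan_le.
Qed.

(** * The canonical form and the equivalence *)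

Lemma jordan_formE (R : realType) (A B : cstarAlg R) (u P : B) (J : A -> B) a :
  jordan_form u P J a = u * mix P (J a).
Proof. by rewrite /jordan_form /mix [RHS]mulrDr !mulrA. Qed.

Lemma jordan_form_rl (R : realType) (A B : cstarAlg R) (u P : B) (J : A -> B) :
  unitary u -> central_projection P -> jordan_star_iso J ->
  rl_isometry (jordan_form u P J) /\ forall y, exists x, jordan_form u P J x = y.
Proof.
move=> uu HP HJ; split.
  have -> : jordan_form u P J = (fun x => u * x) \o (mix P \o J).
    by apply/funext => a; exact: jordan_formE.
  exact: rl_comp (rl_comp (jordan_rl HJ) (mix_rl HP)) (rl_mul uu).
move=> y; have [K _ [_ KJ]] := jordan_inverse HJ; exists (K (mix P (star u * y))).
by rewrite jordan_formE KJ (mixK HP) mulrA uu.2 mul1r.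
Qed.

Lemma isometry_onE (R : realType) (A B : cstarAlg R) (G : set A) (T : A -> B) :
  isometry_on G T <-> forall a b, G a -> G b -> nrm (T a - T b) = nrm (a - b).
Proof.
split=> H a b Ga Gb; first by rewrite /nrm H.
by rewrite !normE H.
Qed.

Theorem theorem2p1 (R : realType) (A B : cstarAlg R)
    (GA : set A) (GB : set B) (T : A -> B)
    (hGA : open_subgroup GA) (hGB : open_subgroup GB)
    (hT : set_bij GA GB T) :
  (isometry_on GA T <->
    unitary (T 1) /\
    exists (P : B) (J : A -> B),
      [/\ central_projection P, jordan_star_iso J
        & forall a, GA a -> T a = jordan_form (T 1) P J a]) /\
  (forall (P : B) (J : A -> B),
    unitary (T 1) -> central_projection P -> jordan_star_iso J ->
    (forall a, GA a -> T a = jordan_form (T 1) P J a) ->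
    [/\ real_linear (jordan_form (T 1) P J),
        isometry_on setT (jordan_form (T 1) P J)
      & range (jordan_form (T 1) P J) = setT]).
Proof.
have [TG Tinj Tsurj] := hT.
have form (P : B) (J : A -> B) : unitary (T 1) -> central_projection P -> jordan_star_iso J ->
    [/\ real_linear (jordan_form (T 1) P J),
        isometry_on setT (jordan_form (T 1) P J)
      & range (jordan_form (T 1) P J) = setT].
  move=> uu HP HJ; have [HS sS] := jordan_form_rl uu HP HJ; split.
  - by case: HS.
  - by apply/isometry_onE => a b _ _; rewrite -(rlB HS) (rlI HS).
  - by apply/seteqP; split=> // y _; have [x <-] := sS y; exists x.
split; last by move=> P J uu HP HJ _; exact: form.
split; last first.
  move=> [uu [P [J [HP HJ TE]]]] a b aG bG; rewrite (TE a aG) (TE b bG).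
  by have [_ iso _] := form _ _ uu HP HJ; exact: iso.
move=> /isometry_onE TI.
have [||L [HL sL TL]] := isometry_extension hGA hGB _ _ TI.
- by move=> a aG; exact: TG.
- by move=> b /Tsurj[a aG <-]; exists a.
have T1 : T 1 = L 1 by apply: TL; exact: osg1 hGA.
have uu : unitary (T 1).
  rewrite T1; apply: rl_unitary => //; first exact: unitary1.
  by rewrite -T1; apply: (osg_inv hGB); apply: TG; exact: osg1 hGA.
split=> //; set u := T 1 in uu *.
pose F x := star u * L x.
have HF : rl_isometry F by exact: rl_comp HL (rl_mul (star_unitary uu)).
have sF y : exists x, F x = y.
  by have [x e] := sL (u * y); exists x; rewrite /F e mulrA uu.1 mul1r.
have F1 : F 1 = 1 by rewrite /F -T1 uu.1.
(* [mix] is its own inverse, so F is recovered from J = [mix P] applied to F. *)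
exists (2^-1 *r (1 - ii B * F (ii A))).
exists (fun x => mix (2^-1 *r (1 - ii B * F (ii A))) (F x)); split.
- exact: image_ii_proj.
- exact: kadison_jordan.
move=> a aG; rewrite jordan_formE (mixK (image_ii_proj HF sF F1)).
by rewrite /F mulrA uu.2 mul1r; exact: TL.
Qed.
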